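(* Let $G$ be a finite group. If $A$ and $B$ are modular subgroups of $G$, then every chief factor of $G$ between $(A\cap B)_{G}$ and $(A\cap B)^{G}$ is cyclic.
   Context: For $X\le G$: $X^{G}$ is the normal closure of $X$ in $G$ and $X_{G}=\bigcap_{x\in G}X^{x}$ is the core of $X$ in $G$. A chief factor of $G$ between normal subgroups $L\le T$ is a section $H/K$ with $H,K$ normal in $G$, $L\le K<H\le T$, and $H/K$ a minimal normal subgroup of $G/K$. A subgroup $M$ of $G$ is modular in $G$ if $M$ is a modular element (in the sense of Kurosh) of the lattice of all subgroups of $G$, that is: (1) $\langle X, M\cap Z\rangle=\langle X,M\rangle\cap Z$ for all subgroups $X\le Z\le G$; and (2) $\langle M, Y\cap Z\rangle=\langle M,Y\rangle\cap Z$ for all subgroups $Y,Z\le G$ with $M\le Z$. *)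

(* Defs.v *)
From HB Require Import structures.
From mathcomp Require Import all_boot all_order all_fingroup all_solvable.

Set Implicit Arguments.
Unset Strict Implicit.
Unset Printing Implicit Defensive.

Import GroupScope.

(* M is a modular element (in Kurosh's sense) of the subgroup lattice of G. *)
Definition modular_subgroup (gT : finGroupType) (G M : {group gT}) : Prop :=
  [/\ M \subset G,
      forall X Z : {group gT}, X \subset Z -> Z \subset G ->
        X <*> (M :&: Z) = (X <*> M) :&: Z
    & forall Y Z : {group gT}, Y \subset G -> Z \subset G -> M \subset Z ->
        M <*> (Y :&: Z) = (M <*> Y) :&: Z].

Definition normal_closure (gT : finGroupType) (G X : {set gT}) : {set gT} :=
  <<class_support X G>>.

(* The arguments of chief_factor are in the order G, K, H for a section H / K. *)
Lemma chief_factorP (gT : finGroupType) (G K H : {group gT}) :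
  reflect [/\ K <| G, H <| G, K \proper H & minnormal (H / K) (G / K)]
          (chief_factor G K H).
Proof.
apply: (iffP idP) => [chHK | [nKG nHG prKH minHK]].
  have /andP[/maxgroupp/andP[prKH nKG] nHG] := chHK.
  split=> //; last exact: chief_factor_minnormal.
  by rewrite /normal nKG (subset_trans (proper_sub prKH)) ?normal_sub.
rewrite /chief_factor nHG andbT; apply: minnormal_maxnormal => //.
- by rewrite /normal (proper_sub prKH)
             (subset_trans (normal_sub nHG)) ?normal_norm.
- exact: normal_norm.
Qed.

(* Main.v *)
Require Import Defs.
From mathcomp Require Import all_boot all_order all_fingroup all_solvable.

Set Implicit Arguments.
Unset Strict Implicit.
Unset Printing Implicit Defensive.

Import GroupScope.
Import FiniteModule.

(** It is enough to treat one modular subgroup [M]: every chief factor of [G]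
between the core [M_G] and the normal closure [M^G] is cyclic
([modular_factors]). Indeed, let [H / K] be a chief factor between the core and
the closure of [A :&: B]. If [A_G] avoids [H / K], then [H / K] is isomorphic to
a chief factor between [A_G] and [A^G]; otherwise it is isomorphic to a chief
factor below [A_G], which [B_G] avoids because [A_G :&: B_G] is contained in
[K], and which is then isomorphic to one between [B_G] and [B^G].

Passing to [G / M_G], let [M] be core-free. The basic tool is a dichotomy for
[T = <M, x>] with [x] a [p]-element ([modular_cycle_dichotomy]): either [M]
contains the residual [O^p(T)], or [M] is maximal in [T], and then [M] is normal
in [T] or [T / M_T] is nonabelian of order the product of two primes
([modular_maximal_struct]). Consequently every element of prime power order
normalises a residual [O^q(M)], from which it follows that [M] is nilpotent
([modular_corefree_nilpotent]).

Write [M = Q E] with [Q] the Sylow [q]-subgroup and [E] its complement. Every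
element of prime power order normalises [Q] or [E], so [G = 'N_G(Q) 'N_G(E)]. It
is shown that the chief factors below [Q^G] are cyclic
([coreFree_pcore_factors]); as [M^G] is contained in the product of the
subgroups [Q^G], this suffices.

If [O^q(G)] normalises [Q], then [Q] permutes with the cyclic [q]-subgroups of
[G], and a coprime action argument ([permutable_coprime_comm]) shows that
[O^q(G)] centralises [Q], hence [Q^G], which is a [q]-group; so the chief factors
below [Q^G] are central.

Otherwise consider the modular [q]-subgroup [M / E] of ['N_G(E) / E]. It is
core-free, and it is maximal and not normal in some subgroup. This implies that
[M / E] has order [q] and is a Sylow subgroup centralised by its normaliser, and
Burnside's theorem leads to a normal subgroup all of whose subgroups are normal
and whose product with [M / E] contains the closure of [M / E]
([bad_structure]). Pulled back to [Q^G], it gives a subgroup [P] of [Q^G] all of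
whose subgroups are normal in [G], with [Q^G / P] cyclic. *)

(** * Modular subgroups *)

Section ModularBasics.

Variable gT : finGroupType.
Implicit Types G H K M N X Y Z T : {group gT}.

Lemma modularJ G M g :
  g \in G -> modular_subgroup G M -> modular_subgroup G (M :^ g)%G.
Proof.
move=> Gg [sMG m1 m2].
have GJ (X : {group gT}) : (X :^ g^-1 \subset G) = (X \subset G).
  by rewrite -{1}(conjGid (groupVr Gg)) conjSg.
split=> [|X Z sXZ sZG | Y Z sYG sZG sMZ] /=.
- by rewrite -(conjGid Gg) conjSg.
- apply: (@conjsg_inj _ g^-1); rewrite conjYg !conjIg conjYg !conjsgK.
  by apply: (m1 (X :^ g^-1)%G (Z :^ g^-1)%G); rewrite ?conjSg ?GJ.
apply: (@conjsg_inj _ g^-1); rewrite conjYg !conjIg conjYg !conjsgK.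
apply: (m2 (Y :^ g^-1)%G (Z :^ g^-1)%G); rewrite ?GJ //=.
by rewrite -sub_conjg.
Qed.

(** The trace of a modular subgroup on a subgroup [H] is modular in [H]. In the
    second law [Z] is replaced by [<Z, M>], whose trace on [H] is [Z] by the
    first law. *)
Lemma modular_setI G M H :
  H \subset G -> modular_subgroup G M -> modular_subgroup H (M :&: H)%G.
Proof.
move=> sHG [sMG m1 m2]; split=> /= [|X Z sXZ sZH | Y Z sYH sZH sMZ].
- exact: subsetIr.
- have sZG := subset_trans sZH sHG.
  rewrite -setIA (setIidPr sZH) m1 //; apply/eqP; rewrite eqEsubset.
  rewrite [X in _ && X]setSI ?genS ?setUS ?subsetIl // andbT.
  rewrite subsetI subsetIr andbT -m1 // join_subG joing_subl /=.
  by rewrite sub_gen ?subsetU // subsetI subsetIl (subset_trans _ sZH) ?subsetIr ?orbT.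
have [sYG sZG] := (subset_trans sYH sHG, subset_trans sZH sHG).
apply/eqP; rewrite eqEsubset; apply/andP; split.
  rewrite join_subG !subsetI joing_subl sMZ /= subsetIr andbT.
  by rewrite (subset_trans _ (joing_subr _ _)) ?subsetIl.
have eqYZ : Y :&: (Z <*> M) = Y :&: Z.
  have: (Z <*> M) :&: H = Z by rewrite -m1 //; apply/joing_idPl.
  by move=> eqZ; rewrite -(setIidPl sYH) -setIA [H :&: _]setIC eqZ setIAC -setIA (setIidPl sZH).
have sZMG : Z <*> M \subset G by rewrite join_subG sZG.
have := m2 Y (Z <*> M)%G sYG sZMG (joing_subr _ _); rewrite /= eqYZ => eqM.
have -> : (M :&: H) <*> (Y :&: Z) = (M <*> (Y :&: Z)) :&: H.
  have sYZH : Y :&: Z \subset H by rewrite subIset ?sYH.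
  by have /= := m1 (Y :&: Z)%G H sYZH sHG; rewrite ![(Y :&: Z) <*> _]joingC.
rewrite eqM !subsetI (subset_trans (subsetIl _ _)) /=; last first.
  by rewrite genS ?setSU ?subsetIl.
rewrite (subset_trans (subsetIr _ _)) ?joing_subl //=.
by rewrite (subset_trans (subsetIr _ _)).
Qed.

Lemma modularS G H M :
  M \subset H -> H \subset G -> modular_subgroup G M -> modular_subgroup H M.
Proof.
move=> sMH sHG /(modular_setI sHG); congr modular_subgroup.
by apply: val_inj; rewrite /= (setIidPl sMH).
Qed.

End ModularBasics.

Lemma modular_quotient (gT : finGroupType) (G M N : {group gT}) :
  N <| G -> modular_subgroup G M -> modular_subgroup (G / N) (M / N).
Proof.
move=> nsNG [sMG m1 m2]; have nNG := normal_norm nsNG.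
split; first exact: quotientS.
- move=> X' Z' sXZ' sZG'; have sXG' := subset_trans sXZ' sZG'.
  have [X defX sNX sXG] := inv_quotientS nsNG sXG'.
  have [Z defZ sNZ sZG] := inv_quotientS nsNG sZG'.
  have sXZ : X \subset Z.
    by move: sXZ'; rewrite defX defZ quotientSGK // (subset_trans sXG).
  have nN (H : {group gT}) : H \subset G -> H \subset 'N(N).
    by move=> sHG; apply: subset_trans nNG.
  rewrite /= defX defZ -quotientIG // -!quotientY ?nN //; last by rewrite subIset ?sMG.
  by rewrite (m1 X Z) // quotientIG.
move=> Y' Z' sYG' sZG' sMZ'.
have [Y defY sNY sYG] := inv_quotientS nsNG sYG'.
have [Z defZ sNZ sZG] := inv_quotientS nsNG sZG'.
have nN (H : {group gT}) : H \subset G -> H \subset 'N(N).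
  by move=> sHG; apply: subset_trans nNG.
have sMZ : M \subset Z.
  by move: sMZ'; rewrite defZ quotientSGK // nN.
rewrite /= defY defZ -quotientIG // -!quotientY ?nN //; last by rewrite subIset ?sYG.
by rewrite (m2 Y Z) // quotientIG.
Qed.

Section Overgroups.

Variable gT : finGroupType.
Implicit Types G H K M N X Y Z T : {group gT}.

(** The subgroups between [M] and [<M, Y>] are determined by their trace on
    [Y]; the main use is with [Y] cyclic of prime power order. *)
Lemma modular_overgroup G M Y Z :
    modular_subgroup G M -> Y \subset G ->
    M \subset Z -> Z \subset M <*> Y ->
  Z :=: M <*> (Y :&: Z).
Proof.
move=> [sMG _ m2] sYG sMZ sZMY.
by rewrite m2 ?(setIidPr sZMY) // (subset_trans sZMY) // join_subG sMG.
Qed.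

(** The trace of [<X, M>] on an overgroup of [X] that meets [M] in [X]. *)
Lemma modular_trace G M X Z :
    modular_subgroup G M -> X \subset Z -> Z \subset G -> M :&: Z \subset X ->
  (X <*> M) :&: Z = X.
Proof.
by move=> [sMG m1 _] sXZ sZG sMZX; rewrite -m1 //; apply/joing_idPl.
Qed.

Lemma maximal_overP M G :
  reflect (M \proper G /\ forall Z, M \subset Z -> Z \subset G -> Z :=: M \/ Z :=: G)
          (maximal M G).
Proof.
apply: (iffP idP) => [maxM | [prMG maxM]].
  have prMG := maxgroupp maxM; split=> //.
  by have /maximal_eqP[] : maximal_eq M G by rewrite /maximal_eq maxM orbT.
apply/maxgroupP; split=> // Z prZG sMZ.
case: (maxM Z sMZ (proper_sub prZG)) => // eqZG.
by rewrite eqZG properxx in prZG.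
Qed.

Lemma maximal_join G M Z :
  maximal M G -> Z \subset G -> ~~ (Z \subset M) -> M <*> Z = G.
Proof.
case/maximal_overP=> /proper_sub sMG maxM sZG not_sZM.
have [||eqM|//] := maxM (M <*> Z)%G; rewrite ?joing_subl ?join_subG ?sMG //.
by case/negP: not_sZM; rewrite -[gval M]eqM joing_subr.
Qed.

Lemma maximal_norm G M : maximal M G -> ~~ (M <| G) -> 'N_G(M) = M.
Proof.
case/maximal_overP=> /proper_sub sMG maxM nnM.
have [||//|eqG] := maxM 'N_G(M)%G; rewrite ?subsetIl ?subsetI ?sMG ?normG //.
by case/negP: nnM; rewrite /normal sMG -{1}eqG subsetIr.
Qed.

(** A modular maximal subgroup meets every subgroup not inside it in a
    maximal subgroup of the latter. *)
Lemma modular_maximal_setI G M H :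
    modular_subgroup G M -> maximal M G -> H \subset G -> ~~ (H \subset M) ->
  maximal (M :&: H) H.
Proof.
move=> modM maxM sHG not_sHM; apply/maximal_overP; split.
  by rewrite properE subsetIr subsetI subxx andbT.
move=> Z sMHZ sZH; have sZG := subset_trans sZH sHG.
have [sZM | not_sZM] := boolP (Z \subset M).
  by left; apply/eqP; rewrite eqEsubset sMHZ subsetI sZM sZH.
right; rewrite -[RHS](setIidPr sHG) -(maximal_join maxM sZG not_sZM) joingC.
by rewrite (modular_trace modM).
Qed.

(** Conversely, a modular subgroup is maximal in [<M, H>] as soon as its trace
    on [H] is. *)
Lemma modular_maximal_join G M H :
    modular_subgroup G M -> H \subset G -> maximal (M :&: H) H ->
  maximal M (M <*> H).
Proof.
move=> modM sHG /maximal_overP[prMH maxMH]; apply/maximal_overP; split.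
  rewrite properE joing_subl join_subG subxx /=; apply: contraL prMH => sHM.
  by rewrite /= (setIidPr sHM) properxx.
move=> Z sMZ sZMH; have defZ := modular_overgroup modM sHG sMZ sZMH.
have [||eqZ|eqZ] := maxMH (H :&: Z)%G; rewrite ?subsetIl ?subsetI ?subsetIr //=.
- by rewrite (subset_trans (subsetIl _ _)).
- by left; rewrite defZ eqZ; apply/joing_idPl/subsetIl.
by right; rewrite defZ eqZ.
Qed.

(** The subgroups of a cyclic group of prime power order form a chain. *)
Lemma cyclic_pgroup_chain (p : nat) (X H K : {group gT}) :
    cyclic X -> p.-group X -> H \subset X -> K \subset X ->
  (H \subset K) || (K \subset H).
Proof.
move=> cycX pX sHX sKX; rewrite -(cardSg_cyclic cycX sHX sKX) -(cardSg_cyclic cycX sKX sHX).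
rewrite (card_pgroup (pgroupS sHX pX)) (card_pgroup (pgroupS sKX pX)).
by case/orP: (leq_total (logn p #|H|) (logn p #|K|)) => le; rewrite (dvdn_exp2l p le) ?orbT.
Qed.

End Overgroups.

(** * The p-residual *)

(** [pres p G] is the subgroup usually written O^p(G), the smallest normal
    subgroup of [G] with quotient a [p]-group; it is defined here as the
    subgroup generated by the elements of order prime to [p]. *)
Definition pres (gT : finGroupType) (p : nat) (G : {set gT}) : {set gT} :=
  <<[set x in G | p^'.-elt x]>>.

Canonical pres_group (gT : finGroupType) p (G : {set gT}) : {group gT} :=
  Eval hnf in [group of pres p G].

Section Residual.

Variables (gT : finGroupType) (p : nat).
Implicit Types G H K M N : {group gT}.

Lemma mem_pres G x : x \in G -> p^'.-elt x -> x \in pres p G.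
Proof. by move=> Gx p'x; rewrite mem_gen // inE Gx. Qed.

Lemma pres_sub_gen G H :
  (forall x, x \in G -> p^'.-elt x -> x \in H) -> pres p G \subset H.
Proof.
by move=> sGH; rewrite gen_subG; apply/subsetP => x; rewrite inE => /andP[]; apply: sGH.
Qed.

Lemma pres_sub G : pres p G \subset G.
Proof. exact: pres_sub_gen. Qed.

Lemma presS G H : H \subset G -> pres p H \subset pres p G.
Proof. by move=> sHG; apply: pres_sub_gen => x /(subsetP sHG); apply: mem_pres. Qed.

Lemma norm_pres G : 'N(G) \subset 'N(pres p G).
Proof.
apply: norms_gen; apply/subsetP=> y nGy; rewrite inE.
by apply/subsetP=> _ /imsetP[x + ->]; rewrite !inE /p_elt orderJ memJ_norm.
Qed.

Lemma pres_normal G : pres p G <| G.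
Proof. by rewrite /normal pres_sub (subset_trans (normG G)) ?norm_pres. Qed.

Lemma pres_eq G H : H \subset G -> pres p G \subset H -> pres p H = pres p G.
Proof.
move=> sHG sGH; apply/eqP; rewrite eqEsubset presS //=; apply: pres_sub_gen => x Gx p'x.
by apply: mem_pres => //; apply: (subsetP sGH); apply: mem_pres.
Qed.

Lemma pgroup_elt (H : {group gT}) : (forall x, x \in H -> p.-elt x) -> p.-group H.
Proof.
move=> pH; apply/pgroupP=> r r_pr /(Cauchy r_pr)[x Hx oxr].
by have := pH x Hx; rewrite /p_elt oxr pnatE.
Qed.

Lemma pres_min G N :
  G \subset 'N(N) -> p.-group (G / N) -> pres p G \subset N.
Proof.
move=> nNG pGN; apply: pres_sub_gen => x Gx p'x.
have nNx := subsetP nNG x Gx; apply: coset_idr => //; apply/eqP.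
rewrite -order_eq1; apply/eqP; apply: (@pnat_1 p).
  by apply: (mem_p_elt pGN); rewrite mem_quotient.
exact: morph_p_elt.
Qed.

End Residual.

Lemma pres_quotient (gT : finGroupType) (p : nat) (G : {group gT}) : p.-group (G / pres p G).
Proof.
apply: pgroup_elt => _ /morphimP[x nx Gx ->].
have cG (pi : nat_pred) (H : {group gT}) : x \in H -> x.`_pi \in H.
  by move=> Hx; apply: groupX.
have xp' : x.`_p^' \in pres p G by rewrite mem_pres ?cG ?p_elt_constt.
rewrite /= -(consttC p x) morphM ?(cG _ 'N(pres p G)%G) //= (coset_id xp') mulg1.
by rewrite morph_p_elt ?p_elt_constt ?(cG _ 'N(pres p G)%G).
Qed.

Lemma pres_pgroup (gT : finGroupType) (p : nat) (G H : {group gT}) :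
  p.-Sylow(G) H -> pres p G * H = G.
Proof.
move=> sylH; have nsP := pres_normal p G.
have sHG := pHall_sub sylH.
apply/eqP; rewrite eqEsubset mul_subG ?pres_sub //=.
have nPH : H \subset 'N(pres p G) by rewrite (subset_trans sHG) ?normal_norm.
rewrite -quotientSK ?normal_norm //.
have sylHq := quotient_pHall nPH sylH.
by rewrite -(pHall_id sylHq) ?pres_quotient.
Qed.

(** * Burnside's transfer theorem *)

(** Burnside's normal complement theorem. Elements of [S] conjugate in [G] are
    equal, so the transfer into [S] maps [g] in [S] to [g ^+ #|G : S|], and its
    kernel is a complement of [S]. *)
Theorem Burnside_transfer (gT : finGroupType) (p : nat) (G S : {group gT}) :
    p.-Sylow(G) S -> 'N_G(S) \subset 'C(S) ->
  exists K : {group gT}, [/\ K <| G, p^'.-group K & K * S = G].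
Proof.
move=> sylS sNC; have sSG := pHall_sub sylS; have pS := pHall_pgroup sylS.
have abS : abelian S by apply: subset_trans sNC; rewrite subsetI sSG normG.
(* Conjugate elements of S are equal. *)
have fusion a y : a \in S -> y \in G -> a ^ y \in S -> a ^ y = a.
  move=> Sa Gy Say; set b := a ^ y.
  have sC (T : {group gT}) : b \in T -> p.-Sylow(G) T -> abelian T ->
      p.-Sylow('C_G[b]) T.
    move=> Tb sylT abT; apply: (pHall_subl _ (subsetIl _ _) sylT).
    by rewrite subsetI (pHall_sub sylT) sub_cent1 (subsetP abT).
  have sylSy : p.-Sylow('C_G[b]) (S :^ y)%G.
    by apply: sC; rewrite ?memJ_conjg ?pHallJ ?abelianJ.
  have [z /setIP[Gz cbz] defS] := Sylow_trans sylSy (sC S Say sylS abS).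
  have Nyz : y * z \in 'N_G(S).
    by rewrite inE groupM //=; apply/normP; rewrite conjsgM -defS.
  have: a ^ (y * z) = a.
    by rewrite conjgE -(centP (subsetP sNC _ Nyz) a Sa) mulKg.
  rewrite conjgM -/b => <-.
  by rewrite conjgE -(cent1P cbz) mulKg.
have abelA : abelian (idm S @* S) by rewrite morphim_idm.
have sI : idm S @* S \subset S by rewrite morphim_idm.
pose f := transfer_morphism G abelA.
have fE g : g \in S -> val (f g) = g ^+ #|G : S|.
  move=> Sg; have Gg := subsetP sSG g Sg.
  have trX := transversalP (rcosets_cycle_partition sSG Gg).
  set X := transversal _ _ in trX.
  rewrite /f /= (transfer_cycle_expansion sSG abelA Gg trX).
  rewrite -(sum_index_rcosets_cycle sSG Gg trX).
  elim/big_rec2: _ => [|x n u Xx].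
    by rewrite expg0.
  move=> IH; rewrite expgD -IH /=; congr (_ * _).
  have Gx : x \in G := subsetP (transversal_sub trX) x Xx.
  have Sgx : (g ^+ #|<[g]> : S :* x|) ^ x^-1 \in S.
    have := mulg_exp_card_rcosets S g x; rewrite mem_rcoset.
    by rewrite conjgE invgK mulgA.
  transitivity (g ^+ #|<[g]> : S :* x| ^ x^-1).
    have memA : g ^+ #|<[g]> : S :* x| ^ x^-1 \in idm S @* S by rewrite morphim_idm.
    exact: (fmodK abelA memA).
  apply: fusion => //; first exact: groupX.
  exact: groupVr.
exists ('ker f)%G.
have tiKS : 'ker f :&: S = 1.
  apply/trivgP/subsetP=> g /setIP[Kg Sg]; rewrite inE.
  have := fE g Sg; rewrite (mker Kg) => /esym/eqP.
  rewrite -order_dvdn => dvd; rewrite -order_eq1; apply/eqP.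
  apply: (@pnat_1 p); first exact: mem_p_elt Sg.
  by apply: pnat_dvd dvd _; case/and3P: sylS.
have oK : #|G : 'ker f| <= #|S|.
  have := card_morphim f G; rewrite setIid => <-.
  rewrite -(card_imset _ val_inj) subset_leq_card //.
  by apply/subsetP=> _ /imsetP[u _ ->]; exact: (subsetP sI _ (fmodP u)).
have defG : 'ker f * S = G.
  apply/eqP; rewrite eqEcard mul_subG ?subsetIl //=.
  by rewrite TI_cardMg // -(Lagrange (subsetIl G _ : 'ker f \subset G)) leq_mul2l oK orbT.
split=> //; first exact: ker_normal.
have -> : p^'.-group ('ker f) = p^'.-nat #|G : S|.
  by have := TI_cardMg tiKS; rewrite defG /pgroup -divgS // => ->; rewrite mulnK.
by case/and3P: sylS.
Qed.

(** * Maximal modular subgroups *)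

(** A group of prime order is centralised by any group that normalises it and
    has no smaller prime divisor. *)
Lemma norm_min_prime_cent (gT : finGroupType) (V U : {group gT}) :
    prime #|V| -> U \subset 'N(V) ->
    (forall r, prime r -> r %| #|U| -> #|V| <= r) ->
  U \subset 'C(V).
Proof.
move=> prV nVU minV; set f := conj_aut V.
have A1 : f @* U = 1.
  apply/eqP; rewrite trivg_card1; apply/idPn=> ntA.
  have ntA' : 1 < #|f @* U| by rewrite ltn_neqAle eq_sym ntA cardG_gt0.
  have prr := pdiv_prime ntA'; have dvr := pdiv_dvd #|f @* U|.
  have := minV _ prr (dvdn_trans dvr (dvdn_morphim _ _)).
  have : pdiv #|f @* U| %| #|V|.-1.
    apply: dvdn_trans dvr _; rewrite -totient_prime // -card_Aut_cyclic ?prime_cyclic //.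
    exact/cardSg/Aut_conj_aut.
  move: (prime_gt1 prV); case: #|V| => // m; rewrite ltnS => m_gt0 /(dvdn_leq m_gt0) le1 le2.
  by have := leq_trans le2 le1; rewrite ltnn.
apply/subsetP=> x Ux; rewrite -ker_conj_aut; apply/kerP; first exact: (subsetP nVU).
by apply/set1P; rewrite -set1gE -A1 mem_morphim // (subsetP nVU).
Qed.

Lemma gcore_quotient1 (gT : finGroupType) (T M : {group gT}) :
  M \subset T -> gcore (M / gcore M T) (T / gcore M T) = 1.
Proof.
move=> sMT; have nsKT := gcore_normal sMT.
have sKM := gcore_sub M T.
set C := gcore (M / _) _; have nsCT : C <| T / gcore M T.
  by rewrite gcore_normal ?quotientS.
have [D defC sKD nsDT] := inv_quotientN nsKT nsCT.
apply/trivgP; rewrite /= defC quotient_sub1 ?normal_norm ?(normalS _ (normal_sub nsDT)) //.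
  apply: gcore_max; last exact: normal_norm.
  rewrite -(quotientSGK _ sKM) ?(subset_trans (normal_sub nsDT)) ?normal_norm //.
  by rewrite -defC gcore_sub.
Qed.

(** By induction, with [M] core-free. Let [S] be a Sylow subgroup for the least
    prime divisor. A conjugate [X] of [M] that does not contain [S] meets [S] in
    a subgroup of prime index normalised by [N(S)], so [[N(S), S]] lies in [X]
    by minimality of the prime. Thus [[N(S), S]] is trivial, and the induction
    applies to the complement of [S] given by Burnside's theorem. *)
Lemma modular_maximal_solvable (gT : finGroupType) (T M : {group gT}) :
  modular_subgroup T M -> maximal M T -> solvable (T / gcore M T).
Proof.
move: {2}_.+1 (ltnSn #|T|) => n.
elim: n => // n IHn in gT T M *; rewrite ltnS => leTn modM maxM.
have sMT : M \subset T := proper_sub (maxgroupp maxM).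
suff solT (aT : finGroupType) (U H : {group aT}) :
    #|U| <= n -> modular_subgroup U H -> maximal H U -> gcore H U = 1 -> solvable U.
  have sKM : gcore M T \subset M := gcore_sub M T.
  have nsKT : gcore M T <| T by rewrite gcore_normal.
  have nsKM : gcore M T <| M by apply: normalS nsKT.
  apply: (solT _ (T / gcore M T)%G (M / gcore M T)%G) => /=.
  - exact: leq_trans (leq_quotient _ _) leTn.
  - exact: modular_quotient.
  - by rewrite quotient_maximal.
  exact: gcore_quotient1.
move=> {gT T M leTn modM maxM sMT} leUn modH maxH H1.
have sHU : H \subset U := proper_sub (maxgroupp maxH).
have gtU : 1 < #|U|.
  by rewrite (leq_trans _ (proper_card (maxgroupp maxH))) // ltnS cardG_gt0.
pose s := pdiv #|U|; have s_pr : prime s := pdiv_prime gtU.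
have minU r : prime r -> r %| #|U| -> s <= r by move/prime_gt1; apply: pdiv_min_dvd.
have [S sylS] := Sylow_exists s U; pose N := 'N_U(S)%G.
have [sSU sS _] := and3P sylS.
have nSN : N \subset 'N(S) := subsetIr _ _.
have sNU : N \subset U := subsetIl _ _.
have sSN : S \subset N by rewrite subsetI sSU normG.
have cSN : N \subset 'C(S).
  rewrite centsC; apply/commG1P/trivgP; rewrite -H1.
  apply/bigcapsP=> t Ut; have modHt := modularJ Ut modH.
  have maxHt : maximal (H :^ t)%G U by rewrite -(conjGid Ut) maximalJ.
  have [sSH | not_sSH] := boolP (S \subset H :^ t).
    by apply: subset_trans sSH; rewrite commg_subl.
  have not_sNH : ~~ (N \subset H :^ t) by apply: contra not_sSH; apply: subset_trans.
  have maxS := modular_maximal_setI modHt maxHt sSU not_sSH.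
  have maxN := modular_maximal_setI modHt maxHt sNU not_sNH.
  have nsS1 := p_maximal_normal sS maxS; have oS1 := p_maximal_index sS maxS.
  set S1 := H :^ t :&: S in nsS1 oS1.
  have nS1N : N \subset 'N(S1).
    rewrite -(maximal_join maxN sSN); last first.
      by apply: contra not_sSH => /subset_trans-> //; apply: subsetIl.
    rewrite join_subG (normal_norm nsS1) andbT normsI //.
      by rewrite (subset_trans (subsetIl _ _)) ?normG.
    by rewrite (subset_trans (subsetIr _ _)).
  have nS1S := subset_trans sSN nS1N.
  apply: subset_trans (subsetIl _ S); rewrite -quotient_cents2 // centsC.
  apply: norm_min_prime_cent; rewrite ?quotient_norms ?card_quotient //= ?oS1 //.
  move=> r r_pr dvr; apply: minU => //.
  by rewrite (dvdn_trans dvr) // (dvdn_trans (dvdn_indexg _ _)) ?cardSg.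
have [K [nsKU s'K defU]] := Burnside_transfer sylS cSN.
have sKU := normal_sub nsKU.
rewrite (series_sol nsKU); apply/andP; split; last first.
  by rewrite -defU quotientMidl quotient_sol // (pgroup_sol sS).
have [sKH | not_sKH] := boolP (K \subset H).
  suff -> : K :=: 1 by apply: solvable1.
  by apply/trivgP; rewrite -H1 gcore_max // normal_norm.
have maxK := modular_maximal_setI modH maxH sKU not_sKH.
have ltKn : #|K| < n.
  apply: leq_trans leUn; rewrite proper_card // properEneq sKU andbT.
  apply: contraTneq s'K => ->; rewrite /pgroup /pnat cardG_gt0 /=.
  by apply/allPn; exists s; rewrite ?inE ?eqxx // mem_primes s_pr cardG_gt0 pdiv_dvd.
have /derivedP[m] := IHn _ _ _ ltKn (modular_setI sKU modH) maxK.
have sHKK : H :&: K \subset K := subsetIr _ _.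
rewrite -quotient_der ?gcore_norm // => Km1.
have sKmC : K^`(m) \subset gcore (H :&: K) K.
  by rewrite -quotient_sub1 ?Km1 // (subset_trans (der_sub _ _)) ?gcore_norm.
apply/derivedP; exists m.
apply/trivgP; rewrite -H1.
rewrite gcore_max ?(normal_norm (gFnormal_trans _ nsKU)) //.
by rewrite (subset_trans sKmC) // (subset_trans (gcore_sub _ _)) ?subsetIl.
Qed.

Lemma norm_cyclic_commg_cent (gT : finGroupType) (V A B : {group gT}) :
  cyclic V -> A \subset 'N(V) -> B \subset 'N(V) -> [~: A, B] \subset 'C(V).
Proof.
move=> cycV nVA nVB; rewrite -ker_conj_aut.
have nVAB : [~: A, B] \subset 'N(V).
  by apply: subset_trans (commgSS nVA nVB) _; rewrite commg_subl normG.
suff f1 : conj_aut V @* [~: A, B] = 1.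
  apply/subsetP=> x ABx; apply/kerP; first exact: (subsetP nVAB).
  by apply/set1P; rewrite -set1gE -f1 mem_morphim // (subsetP nVAB).
rewrite morphimR //; apply/commG1P.
apply: subset_trans (Aut_conj_aut _ _) _.
apply: subset_trans (Aut_cyclic_abelian cycV) _.
by rewrite centS // Aut_conj_aut.
Qed.

Lemma maximal1_prime (gT : finGroupType) (H : {group gT}) :
  maximal 1 H -> prime #|H|.
Proof.
case/maximal_overP=> pr1H max1.
have gtH : 1 < #|H| by rewrite cardG_gt1 -proper1G.
have [x Hx ox] := Cauchy (pdiv_prime gtH) (pdiv_dvd #|H|).
have [||x1|<-] := max1 <[x]>%G; rewrite ?sub1G ?cycle_subG //=.
  by have := pdiv_prime gtH; rewrite -ox orderE x1 cards1.
by rewrite -orderE ox pdiv_prime.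
Qed.

(** A modular maximal subgroup [M] that is not normal has prime index, its core
    [K] has prime index [q] in [M], and [T / K] is nonabelian of order [r * q]
    with [q < r]; [R] is the subgroup such that [R / K] has order [r]. *)
Lemma modular_maximal_struct (gT : finGroupType) (T M : {group gT}) :
    modular_subgroup T M -> maximal M T -> ~~ (M <| T) ->
  [/\ prime #|T : M|, prime #|M : gcore M T|, #|M : gcore M T| < #|T : M|
    & exists R : {group gT}, [/\ R <| T, gcore M T \subset R, R :&: M = gcore M T
                             & #|R : gcore M T| = #|T : M|]].
Proof.
move=> modM maxM nnM; have sMT : M \subset T := proper_sub (maxgroupp maxM).
have sKM : gcore M T \subset M := gcore_sub M T.
have nsKT : gcore M T <| T by rewrite gcore_normal.
have nsKM : gcore M T <| M by apply: normalS nsKT.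
suff core1 (aT : finGroupType) (U H : {group aT}) :
    modular_subgroup U H -> maximal H U -> ~~ (H <| U) -> gcore H U = 1 -> solvable U ->
    [/\ prime #|U : H|, prime #|H|, #|H| < #|U : H|
      & exists R : {group aT}, [/\ R <| U, R :&: H = 1 & #|R| = #|U : H|]].
  have [|||||] := core1 _ (T / gcore M T)%G (M / gcore M T)%G.
  - exact: modular_quotient.
  - by rewrite quotient_maximal.
  - by apply: contra nnM => /=; rewrite -cosetpre_normal !quotientGK.
  - exact: gcore_quotient1.
  - exact: modular_maximal_solvable.
  have nKT := normal_norm nsKT; have nKM := normal_norm nsKM.
  have iTM : #|T / gcore M T : M / gcore M T| = #|T : M|.
    by rewrite index_quotient_eq // (subset_trans (subsetIr _ _)).
  have iM : #|M / gcore M T| = #|M : gcore M T| by rewrite card_quotient.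
  rewrite /= iTM iM => pr1 pr2 lt [R' [nsR' tiR' oR']]; split=> //.
  have [R defR sKR nsR] := inv_quotientN nsKT nsR'.
  exists R; split=> //; last first.
    by rewrite -oR' defR card_quotient // (subset_trans (normal_sub nsR)).
  apply/eqP; rewrite eqEsubset subsetI sKR sKM !andbT -quotient_sub1; last first.
    by rewrite subIset // nKM orbT.
  by rewrite quotientIG //= -defR tiR'.
move=> {gT T M modM maxM nnM sMT sKM nsKT nsKM}.
move=> modH maxH nnH core1 solU.
have sHU : H \subset U := proper_sub (maxgroupp maxH).
have ntU : U :!=: 1.
  by apply: contraNneq nnH => U1; rewrite /normal sHU U1 sub1G.
(* A minimal normal subgroup N has the complement H, which acts faithfully on N. *)
have [N [sNU nsNU ntN /is_abelemP[p p_pr abelN]]] := solvable_norm_abelem solU (normal_refl U) ntU.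
have cNN := abelem_abelian abelN.
have not_sNH : ~~ (N \subset H).
  apply: contra ntN => sNH; apply/eqP/trivgP; rewrite -core1.
  by rewrite gcore_max // normal_norm.
have nNH := subset_trans sHU (normal_norm nsNU).
have defU : N * H = U by rewrite -norm_joinEr // joingC (maximal_join maxH).
have tiNH : N :&: H = 1.
  apply/trivgP; rewrite -core1 gcore_max ?subsetIr //.
  rewrite -defU mul_subG //; last by rewrite normsI ?normG.
  by rewrite cents_norm // centsC (subset_trans (subsetIl _ _)).
have /(p_maximal_index (abelem_pgroup abelN)) : maximal (H :&: N) N.
  exact: modular_maximal_setI modH maxH sNU not_sNH.
rewrite /= [H :&: N]setIC tiNH indexg1 => oN.
have iUH : #|U : H| = #|N|.
  by rewrite -divgS // -defU TI_cardMg // mulnK.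
have cHN : 'C_H(N) = 1.
  apply/trivgP; rewrite -core1 gcore_max ?subsetIl //.
  rewrite -defU mul_subG //; first by rewrite cents_norm // centsC subsetIr.
  by rewrite normsI ?normG ?norms_cent.
have prN : prime #|N| by rewrite oN.
have cHH : abelian H.
  apply/commG1P/trivgP; rewrite -cHN subsetI commg_subl normG.
  by rewrite norm_cyclic_commg_cent ?prime_cyclic.
have [x Ux not_Hx] : exists2 x, x \in U & x \notin 'N(H).
  by apply/subsetPn; apply: contra nnH => nHU; rewrite /normal sHU.
have modHx := modularJ Ux modH.
have maxHx : maximal (H :^ x)%G U by rewrite -(conjGid Ux) maximalJ.
have not_sHx : ~~ (H :^ x \subset H).
  by apply: contra not_Hx => sHx; rewrite inE.
have D1 : H :^ x :&: H = 1.
  apply/trivgP; rewrite -core1 gcore_max ?subsetIr //.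
  rewrite -{1}(maximal_join maxH (proper_sub (maxgroupp maxHx)) not_sHx) join_subG.
  rewrite !cents_norm //.
    by rewrite centsC (subset_trans (subsetIl _ _)) // -[_ \subset _]/(abelian (H :^ x)) abelianJ.
  by rewrite centsC (subset_trans (subsetIr _ _)).
have prH : prime #|H|.
  apply: maximal1_prime; have := modular_maximal_setI modHx maxHx sHU.
  rewrite /= D1; apply; apply: contra not_sHx => sHHx.
  by have /eqP <- : H :==: H :^ x by rewrite eqEcard sHHx cardJg leqnn.
split=> //; rewrite ?iUH //; last by exists N; rewrite nsNU.
rewrite ltnNge; apply/negP=> leNH.
have : H \subset 'C(N).
  apply: norm_min_prime_cent => // r r_pr; rewrite dvdn_prime2 // => /eqP ->.
  exact: leNH.
by move/setIidPl; rewrite cHN => H1; rewrite -H1 cards1 in prH.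
Qed.

(** * The join of a modular subgroup with an element of prime power order *)

Lemma pelt_notin (gT : finGroupType) (B H : {group gT}) :
  ~~ (B \subset H) -> exists u p, [/\ u \in B, u \notin H, prime p & p.-elt u].
Proof.
case/subsetPn=> x Bx not_Hx.
have [/forall_inP allH | /forall_inPn[p _ not_Hxp]] :=
  boolP [forall (p : 'I_#[x].+1 | true), x.`_p \in H].
  case/negP: not_Hx; rewrite -(prod_constt x) big_mkord; apply: group_prod => p _.
  exact: allH.
exists x.`_p, p; split=> //; [exact: groupX | | exact: p_elt_constt].
case: (boolP (prime p)) => // npr; case/negP: not_Hxp; rewrite (_ : x.`_p = 1) //.
apply/constt1P/pnatP=> // r r_pr _; apply/negP=> /eqP erp.
by case/negP: npr; rewrite -erp.
Qed.

(** The elements of prime power order generate. *)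
Lemma pelt_gen_sub (gT : finGroupType) (B H : {group gT}) :
  (forall x p, prime p -> p.-elt x -> x \in B -> x \in H) -> B \subset H.
Proof.
move=> allH; apply/idPn=> /pelt_notin[u [p [Bu not_Hu p_pr pu]]].
by rewrite (allH u p) in not_Hu.
Qed.

Lemma p'elt_notin (gT : finGroupType) (q : nat) (B H : {group gT}) :
    ~~ (pres q B \subset H) ->
  exists u p, [/\ u \in B, u \notin H, prime p, p != q & p.-elt u].
Proof.
move=> not_sBH; have [y /andP[By /andP[q'y not_Hy]]] : exists y, [&& y \in B, q^'.-elt y & y \notin H].
  apply/existsP; apply: contraNT not_sBH => /existsPn nex; apply: pres_sub_gen => y By q'y.
  by move/(_ y): nex; rewrite By q'y /= negbK.
have [|u [p [yu not_Hu p_pr pu]]] := @pelt_notin _ <[y]>%G H; first by rewrite cycle_subG.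
exists u, p; split=> //; first by apply: subsetP yu; rewrite cycle_subG.
apply: contraNneq not_Hu => epq; suff -> : u = 1 by [].
apply/eqP; rewrite -order_eq1; apply/eqP; apply: (@pnat_1 q); first by rewrite -epq.
exact: mem_p_elt yu.
Qed.

Lemma cycle_proper_sub (gT : finGroupType) (p : nat) (x : gT) (H : {group gT}) :
  prime p -> p.-elt x -> H \subset <[x]> -> x \notin H -> H \subset <[x ^+ p]>.
Proof.
move=> p_pr px sHx not_Hx; apply/subsetP=> h Hh.
have /cycleP[i def_h] := subsetP sHx h Hh.
have [/dvdnP[k ei] | not_pi] := boolP (p %| i).
  by rewrite def_h ei mulnC expgM mem_cycle.
case/negP: not_Hx; apply: (subsetP (_ : <[h]> \subset H)); first by rewrite cycle_subG.
have : generator <[x]> (x ^+ i).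
  rewrite generator_coprime; apply: (@pnat_coprime p) => //.
  by rewrite p'natE.
by rewrite -def_h => /eqP <-; rewrite cycle_id.
Qed.

Section UniqueMax.

Variables (gT : finGroupType) (T M : {group gT}).
Hypothesis modM : modular_subgroup T M.

(** If [T = <M, x>] with [x] of prime power order, then [M] lies in a unique
    maximal subgroup of [T]. *)
Lemma modular_unique_max (p : nat) (x : gT) :
    prime p -> p.-elt x -> x \notin M -> M <*> <[x]> = T ->
  exists L : {group gT}, [/\ maximal L T, L :=: M <*> <[x ^+ p]>
    & forall Z : {group gT}, M \subset Z -> Z \subset T -> ~~ (Z \subset L) -> Z :=: T].
Proof.
move=> p_pr px not_Mx defT.
have sMT : M \subset T by case: modM.
have sxT : <[x]> \subset T by rewrite -defT joing_subr.
have hL (Z : {group gT}) : M \subset Z -> Z \subset T -> Z \subset M <*> <[x ^+ p]> \/ Z :=: T.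
  move=> sMZ sZT; have [Zx | not_Zx] := boolP (x \in Z).
    by right; apply/eqP; rewrite eqEsubset sZT -defT join_subG sMZ cycle_subG.
  left; rewrite [gval Z](modular_overgroup modM sxT sMZ); last by rewrite defT.
  rewrite genS ?setUS //; apply: cycle_proper_sub => //; first exact: subsetIl.
  by rewrite inE negb_and not_Zx orbT.
have sxpx : <[x ^+ p]> \subset <[x]> by rewrite cycleX.
have not_xp : x \notin <[x ^+ p]>.
  apply/negP=> xpx; have : generator <[x]> (x ^+ p).
    by rewrite /generator eqEsubset sxpx cycle_subG xpx.
  rewrite generator_coprime => cop; case/negP: not_Mx; suff -> : x = 1 by [].
  apply/eqP; rewrite -order_eq1; apply/eqP; apply: (@pnat_1 p) => //.
  by rewrite p'natE // -prime_coprime // coprime_sym.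
have not_Lx : x \notin M <*> <[x ^+ p]>.
  have sMx : M :&: <[x]> \subset <[x ^+ p]>.
    by apply: cycle_proper_sub; rewrite ?subsetIr // inE negb_and not_Mx.
  have := modular_trace modM sxpx sxT sMx; rewrite joingC => eqx.
  by apply: contra not_xp => Lx; rewrite -eqx inE Lx cycle_id.
have sLT : M <*> <[x ^+ p]> \subset T by rewrite join_subG sMT (subset_trans sxpx).
exists (M <*> <[x ^+ p]>)%G; split=> // [|Z sMZ sZT not_sZL].
  apply/maximal_overP; split=> [|Z sLZ sZT].
    rewrite properE sLT; apply: contra not_Lx => /subsetP-> //.
    by rewrite -cycle_subG.
  case: (hL Z) => //; last by right.
    by rewrite (subset_trans _ sLZ) ?joing_subl.
  by left; apply/eqP; rewrite eqEsubset sLZ andbT.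
by case: (hL Z sMZ sZT) => // sZL; case/negP: not_sZL.
Qed.

(** A subgroup [B] outside the unique maximal overgroup [L] of [M] generates
    [T] with [M], and is generated by [M :&: B] and any of its elements of prime
    power order outside [L]. *)
Lemma modular_trace_gen (L B : {group gT}) :
    (forall Z : {group gT}, M \subset Z -> Z \subset T -> ~~ (Z \subset L) -> Z :=: T) ->
    B \subset T -> ~~ (B \subset L) ->
  M <*> B = T /\ exists u p, [/\ prime p, p.-elt u & (M :&: B) <*> <[u]> = B].
Proof.
move=> uniqL sBT not_sBL; have sMT : M \subset T by case: modM.
have joinT (C : {group gT}) : C \subset T -> ~~ (C \subset L) -> M <*> C = T.
  move=> sCT not_sCL; apply: (uniqL (M <*> C)%G); rewrite ?joing_subl ?join_subG ?sMT //.
  by rewrite negb_and not_sCL orbT.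
split; first exact: joinT.
have [u [p [Bu not_Lu p_pr pu]]] := pelt_notin not_sBL; exists u, p; split=> //.
pose C := ((M :&: B) <*> <[u]>)%G.
have sCB : C \subset B by rewrite join_subG subsetIr cycle_subG.
have not_sCL : ~~ (C \subset L).
  by apply: contra not_Lu => /subsetP->//; apply: (subsetP (joing_subr _ _)); rewrite cycle_id.
have := modular_trace modM sCB sBT (joing_subl _ _).
rewrite [C <*> M]joingC (joinT C (subset_trans sCB sBT) not_sCL).
by rewrite (setIidPr sBT) => /esym.
Qed.

End UniqueMax.

(** A modular subgroup [M] permutes with a [p]-element [x] as soon as it
    contains the [p]-residual of [<M, x>]. *)
Lemma modular_pres_permute (gT : finGroupType) (T M : {group gT}) (p : nat) x :
    modular_subgroup T M -> p.-elt x -> M <*> <[x]> = T -> pres p T \subset M ->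
  M * <[x]> = T.
Proof.
move: {2}_.+1 (ltnSn #|T|) => n.
elim: n => // n IHn in T x *; rewrite ltnS => leTn modM px defT sPM.
have sMT : M \subset T by case: modM.
have sxT : <[x]> \subset T by rewrite -defT joing_subr.
have [->|neMT] := eqVneq (M : {set gT}) T; first by rewrite mulGSid.
have nsP := pres_normal p T; have nPT := normal_norm nsP.
have pTP := pres_quotient p T.
have [eqMT | [N maxN sMN]] := maximal_exists sMT; first by case/eqP: neMT.
have [sNT ltNT] : N \subset T /\ #|N| < #|T|.
  by rewrite (proper_sub (maxgroupp maxN)) (proper_card (maxgroupp maxN)).
have sPN := subset_trans sPM sMN.
have nsNT : N <| T.
  have nsPN : pres p T <| N := normalS sPN sNT nsP.
  have : N / pres p T <| T / pres p T by rewrite (p_maximal_normal pTP) ?quotient_maximal.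
  by rewrite -cosetpre_normal !quotientGK.
have defN : N :=: M <*> (<[x]> :&: N).
  by apply: (modular_overgroup modM sxT sMN); rewrite defT.
have /cyclicP[y def_y] : cyclic (<[x]> :&: N) := cyclicS (subsetIl _ _) (cycle_cyclic x).
have syx : <[y]> \subset <[x]> by rewrite -def_y subsetIl.
have pN : pres p N = pres p T by apply: pres_eq.
have py : p.-elt y by apply: mem_p_elt px _; rewrite -cycle_subG.
have eqN : M * <[y]> = N.
  apply: IHn; rewrite ?pN //; first exact: leq_trans leTn.
    exact: modularS modM.
  by rewrite -def_y -defN.
rewrite -(mulSGid syx) mulgA eqN -norm_joinEr ?(subset_trans sxT) ?normal_norm //.
by apply/eqP; rewrite eqEsubset join_subG sNT sxT -{1}defT genS ?setSU.
Qed.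

Lemma modular_maximal_index (gT : finGroupType) (T M : {group gT}) :
  modular_subgroup T M -> maximal M T -> prime #|T : M|.
Proof.
move=> modM maxM; have [nsM | nnM] := boolP (M <| T); last first.
  by have [] := modular_maximal_struct modM maxM nnM.
rewrite -card_quotient ?normal_norm //; apply: maximal1_prime.
by rewrite -(quotient_maximal (normal_refl M) nsM) trivg_quotient in maxM.
Qed.

Lemma pres1_pgroup (gT : finGroupType) (q : nat) (M : {group gT}) :
  pres q M = 1 -> q.-group M.
Proof.
by move=> P1; have := pres_quotient q M; rewrite P1 -(isog_pgroup _ (quotient1_isog M)).
Qed.

Lemma pres_joing_cycle (gT : finGroupType) (p : nat) (T L : {group gT}) x :
  L <| T -> p.-elt x -> L <*> <[x]> = T -> pres p T \subset L.
Proof.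
move=> nsLT px defT; have nLT := normal_norm nsLT.
have sxT : <[x]> \subset T by rewrite -defT joing_subr.
apply: pres_min => //; rewrite -defT quotientYidl ?(subset_trans sxT) //.
exact: quotient_pgroup.
Qed.

Lemma prime_index_Sylow (gT : finGroupType) (q : nat) (M K Q : {group gT}) :
  K <| M -> #|M : K| = q -> prime q -> q.-Sylow(M) Q -> K * Q = M.
Proof.
move=> nsKM oq q_pr sylQ; have nKM := normal_norm nsKM.
have nKQ := subset_trans (pHall_sub sylQ) nKM.
apply/eqP; rewrite eqEsubset mul_subG ?(normal_sub nsKM) ?(pHall_sub sylQ) //=.
rewrite -quotientSK // -(pHall_id (quotient_pHall nKQ sylQ)) //.
by rewrite /pgroup card_quotient // oq pnat_id.
Qed.

(** The case where the maximal overgroup [L] of [M] is normal in [T]. If [M]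
    were maximal and not normal in [L], a Sylow subgroup of [M] would be one of
    [L]; by the Frattini argument a [p]-element [z] outside [L] normalises it,
    the powers of [z] in [L] normalise [M], hence lie in [M], and [L] would be
    generated by [M] and these powers. *)
Lemma dichotomy_normal_case (gT : finGroupType) (T M L : {group gT}) (p : nat) x :
    modular_subgroup T M -> prime p -> p.-elt x -> M <*> <[x]> = T ->
    maximal L T -> L :=: M <*> <[x ^+ p]> ->
    (forall Z : {group gT}, M \subset Z -> Z \subset T -> ~~ (Z \subset L) -> Z :=: T) ->
    L <| T -> pres p L \subset M \/ maximal M L ->
  pres p T \subset M.
Proof.
move=> modM p_pr px defT maxL defL uniqL nsLT IH.
have [sMT m1 m2] := modM; have sLT := normal_sub nsLT.
have sxT : <[x]> \subset T by rewrite -defT joing_subr.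
have sML : M \subset L by rewrite defL joing_subl.
have modML := modularS sML sLT modM.
have sPL : pres p T \subset L.
  apply: pres_joing_cycle nsLT px _; apply/eqP; rewrite eqEsubset join_subG sLT sxT.
  by rewrite -{1}defT genS ?setSU.
have ePL := pres_eq sLT sPL.
case: IH => [|maxML]; first by rewrite ePL.
have [nsML | nnML] := boolP (M <| L).
  by rewrite -ePL; apply: (pres_joing_cycle nsML _ (esym defL)); rewrite p_eltX.
have [r_pr q_pr ltqr _] := modular_maximal_struct modML maxML nnML.
set q := #|M : gcore M L| in q_pr ltqr.
have nsKL : gcore M L <| L := gcore_normal sML.
have nsKM : gcore M L <| M := normalS (gcore_sub M L) sML nsKL.
have [Q sylQ] := Sylow_exists q M.
have defM := prime_index_Sylow nsKM (erefl _) q_pr sylQ.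
have sylQL : q.-Sylow(L) Q.
  rewrite pHallE (subset_trans (pHall_sub sylQ)) //= (card_Hall sylQ).
  rewrite -(Lagrange sML) partnM ?cardG_gt0 //.
  rewrite (part_p'nat (n := #|L : M|)) ?muln1 // p'natE //.
  by rewrite dvdn_prime2 // neq_ltn ltqr.
have defLN := Frattini_arg nsLT sylQL.
have not_sNL : ~~ ('N_T(Q) \subset L).
  apply/negP=> sNL; have := proper_card (maxgroupp maxL).
  by rewrite -defLN mulGSid // ltnn.
have [y Ny not_Ly] := subsetPn not_sNL.
have Ty : y \in T by case/setIP: Ny.
pose z := y.`_p; have Nz : z \in 'N_T(Q) by apply: groupX.
have Tz : z \in T by case/setIP: Nz.
have not_Lz : z \notin L.
  apply: contra not_Ly => Lz; rewrite -(consttC p y) groupM //.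
  by apply: (subsetP sPL); rewrite mem_pres ?p_elt_constt ?groupX.
have defTz : M <*> <[z]> = T.
  apply: (uniqL (M <*> <[z]>)%G); rewrite ?joing_subl ?join_subG ?sMT ?cycle_subG //.
  by rewrite negb_and not_Lz orbT.
have sLM : L \subset M.
  rewrite [gval L](modular_overgroup modM (_ : <[z]> \subset T) sML) ?defTz ?cycle_subG //.
  rewrite join_subG subxx -(maximal_norm maxML nnML) subsetI subsetIr /= -defM.
  rewrite normsM //; first by rewrite (subset_trans (subsetIr _ _)) ?gcore_norm.
  rewrite (subset_trans (subsetIl _ _)) // cycle_subG.
  by case/setIP: Nz.
by have := proper_card (maxgroupp maxML); rewrite ltnNge subset_leq_card.
Qed.

Lemma prime_elt_sub (gT : finGroupType) (p : nat) (x y : gT) (H : {group gT}) :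
    prime p -> p.-elt x -> y \in <[x]> -> #[y] = p -> H \subset <[x]> -> H :!=: 1 ->
  y \in H.
Proof.
move=> p_pr px xy oy sHx ntH; rewrite -cycle_subG.
rewrite -(cardSg_cyclic (cycle_cyclic x)) ?cycle_subG // -orderE oy.
by have [_ ->] := pgroup_pdiv (pgroupS sHx px) ntH.
Qed.

Lemma pres_maximal_normal (gT : finGroupType) (q : nat) (L T : {group gT}) :
  maximal L T -> pres q T \subset L -> L <| T.
Proof.
move=> maxL sPL; have sLT : L \subset T := proper_sub (maxgroupp maxL).
have nsPT := pres_normal q T; have nsPL : pres q T <| L := normalS sPL sLT nsPT.
have : L / pres q T <| T / pres q T.
  by rewrite (p_maximal_normal (pres_quotient q T)) ?quotient_maximal.
by rewrite -cosetpre_normal !quotientGK.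
Qed.

Lemma diff_prime_TI (gT : finGroupType) (p q : nat) (A B : {group gT}) :
  p != q -> p.-group A -> q.-group B -> A :&: B = 1.
Proof.
move=> neqpq pA qB; apply: coprime_TIg; apply: (pnat_coprime pA).
by apply: (pi_pnat qB); rewrite !inE eq_sym.
Qed.

Lemma joing_overgroup (gT : finGroupType) (A N X T : {group gT}) :
  A <*> X = T -> A \subset N -> N \subset T -> N <*> X = T.
Proof.
move=> defT sAN sNT; apply/eqP; rewrite eqEsubset join_subG sNT.
by rewrite -{1 2}defT joing_subr genS ?setSU.
Qed.

(** The case where the maximal overgroup [L] of the core-free subgroup [M] is
    not normal in [T = <M, x>]. *)
Section NonNormalCase.

Variables (gT : finGroupType) (T M L : {group gT}) (x : gT).
Hypothesis modM : modular_subgroup T M.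
Hypothesis defT : M <*> <[x]> = T.
Hypothesis coreM : gcore M T = 1.
Hypothesis maxL : maximal L T.
Hypothesis sML : M \subset L.
Hypothesis uniqL :
  forall Z : {group gT}, M \subset Z -> Z \subset T -> ~~ (Z \subset L) -> Z :=: T.
Hypothesis nnLT : ~~ (L <| T).

Let sMT : M \subset T. Proof. by case: modM. Qed.
Let sxT : <[x]> \subset T. Proof. by rewrite -defT joing_subr. Qed.
Let sLT : L \subset T. Proof. exact: proper_sub (maxgroupp maxL). Qed.

(** Otherwise the normal closure of [M] lies in [L] and has a cyclic quotient
    in [T], so that [L] is normal. *)
Lemma modular_conj_notin : exists2 t, t \in T & ~~ (M :^ t \subset L).
Proof.
apply/exists_inP; apply: contraR nnLT; rewrite negb_exists_in => /forall_inP allL.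
pose N := <<class_support M T>>%G.
have sNL : N \subset L.
  rewrite gen_subG class_supportEr; apply/bigcupsP=> t Tt.
  by rewrite -[_ \subset _]negbK allL.
have sMN : M \subset N by rewrite sub_gen ?sub_class_support.
have sNT := subset_trans sNL sLT.
have nsNT : N <| T by rewrite /normal sNT norms_gen ?class_support_norm.
have cTN : abelian (T / N).
  rewrite -(joing_overgroup (defT : M <*> <[x]>%G = T) sMN sNT) quotientYidl.
    by rewrite quotient_abelian ?cycle_abelian.
  by rewrite (subset_trans sxT) ?normal_norm.
apply: (sub_der1_normal _ sLT); apply: subset_trans sNL.
exact: der1_min (normal_norm nsNT) cTN.
Qed.

(** Induction hypothesis of the dichotomy. *)
Hypothesis IH : forall (T' M' : {group gT}) (r : nat) u,
    #|T'| < #|T| -> modular_subgroup T' M' -> prime r -> r.-elt u -> M' <*> <[u]> = T' ->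
  pres r T' \subset M' \/ maximal M' T'.

(** [M] and a conjugate [M^t] generate [T], and each is generated by the
    intersection [D] and an element of prime power order. If [M] is not maximal,
    then [D] contains the residuals of [M] and [M^t] by induction, both are the
    residual of [D], so they are normal in [T] and trivial. *)
Lemma nonnormal_pgroup :
  maximal M T \/ exists q t, [/\ prime q, q.-group M, t \in T & M <*> M :^ t = T].
Proof.
have [t Tt not_sMtL] := modular_conj_notin.
have ltMT : #|M| < #|T|.
  by apply: leq_ltn_trans (subset_leq_card sML) (proper_card (maxgroupp maxL)).
pose Mt := (M :^ t)%G; pose Lt := (L :^ t)%G.
have modMt : modular_subgroup T Mt := modularJ Tt modM.
have maxLt : maximal Lt T by rewrite -(conjGid Tt) maximalJ.
have sMtT : Mt \subset T by case: modMt.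
have uniqLt (Z : {group gT}) : Mt \subset Z -> Z \subset T -> ~~ (Z \subset Lt) -> Z :=: T.
  move=> sMtZ sZT not_sZLt.
  have /(congr1 (fun A => A :^ t)) : (Z :^ t^-1)%G :=: T.
    apply: uniqL; first by rewrite /= -sub_conjg.
      by rewrite /= sub_conjgV (conjGid Tt).
    by rewrite /= sub_conjgV.
  by rewrite /= conjsgKV (conjGid Tt).
have [eT [u [r [r_pr ru defMt]]]] := modular_trace_gen modM uniqL sMtT not_sMtL.
have not_sMLt : ~~ (M \subset Lt).
  apply: contraL (maxgroupp maxLt) => sMLt.
  by rewrite properE negb_and negbK -eT join_subG sMLt conjSg sML orbT.
have [_ [v [q [q_pr qv defM]]]] := modular_trace_gen modMt uniqLt sMT not_sMLt.
have [maxM|notmax] := boolP (maximal M T); [by left | right; exists q, t].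
have sPMt : pres r Mt \subset M :&: Mt.
  case: (IH _ (modular_setI sMtT modM) r_pr ru defMt) => //; first by rewrite cardJg.
  by move/(modular_maximal_join modM sMtT); rewrite eT (negPf notmax).
have sPM : pres q M \subset Mt :&: M.
  case: (IH _ (modular_setI sMT modMt) q_pr qv defM) => //.
  move/(modular_maximal_join modMt sMT); rewrite joingC eT.
  by rewrite -(conjGid Tt) maximalJ (negPf notmax).
rewrite setIC in sPM; set D := (M :&: Mt)%G in sPM sPMt.
have sDM : D \subset M := subsetIl _ _; have sDMt : D \subset Mt := subsetIr _ _.
have qMD : q.-nat #|M : D|.
  have nP := normal_norm (pres_normal q M).
  have := pres_quotient q M; rewrite /pgroup card_quotient //.
  by apply: pnat_dvd; apply: indexgS.
have rMD : r.-nat #|M : D|.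
  have -> : #|M : D| = #|Mt : D| by rewrite -!divgS // cardJg.
  have nP := normal_norm (pres_normal r Mt).
  have := pres_quotient r Mt; rewrite /pgroup card_quotient //.
  by apply: pnat_dvd; apply: indexgS.
have eqr : q = r.
  apply/eqP/idPn=> neqr; have : #|M : D| = 1%N.
    apply: (pnat_1 qMD); apply: (pi_pnat rMD).
    by rewrite !inE eq_sym.
  move/eqP; rewrite indexg_eq1 subsetI subxx /= => sMMt.
  have eqMMt : M :=: Mt by apply/eqP; rewrite eqEcard sMMt cardJg leqnn.
  by move: ltMT; rewrite -eT -eqMMt joingE setUid genGid ltnn.
have eqP1 := pres_eq sDM sPM; rewrite -eqr in sPMt; have eqP2 := pres_eq sDMt sPMt.
split=> //; apply: pres1_pgroup; apply/trivgP; rewrite -coreM.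
rewrite gcore_max ?pres_sub // -eT join_subG normal_norm ?pres_normal //.
by rewrite /= -eqP1 eqP2 normal_norm ?pres_normal.
Qed.

Let genT (y : gT) : y \in T -> y \notin L -> M <*> <[y]> = T.
Proof.
move=> Ty not_Ly; apply: (@uniqL (M <*> <[y]>)%G).
- exact: joing_subl.
- by rewrite join_subG sMT cycle_subG.
by rewrite join_subG cycle_subG negb_and not_Ly orbT.
Qed.

(** [T] is generated by [M] and some [r]-element [u], [r != q], and an overgroup
    of [M] that is a [q]-group contains no nontrivial power of [u]. *)
Lemma nonnormal_Sylow (q : nat) : q.-group M -> q.-Sylow(T) M.
Proof.
move=> qM; have not_sPL : ~~ (pres q T \subset L).
  by apply: contra nnLT; apply: pres_maximal_normal.
have [u [r [Tu not_Lu r_pr neqr ru]]] := p'elt_notin not_sPL.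
have [S sylS sMS] := Sylow_superset sMT qM.
have sST := pHall_sub sylS; have suT : <[u]> \subset T by rewrite cycle_subG.
suff -> : M :=: S by [].
rewrite [RHS](modular_overgroup modM suT sMS) ?genT //.
by rewrite (diff_prime_TI neqr ru (pHall_pgroup sylS)) joingG1.
Qed.

(** The generator is chosen in the normaliser of the Sylow subgroup that [M] cuts
    out of the core of [L], which makes that Sylow subgroup normal in [T]. *)
Lemma nonnormal_generator (q : nat) : q.-group M ->
  M :&: gcore L T = 1 /\ exists y r, [/\ prime r, r != q, r.-elt y, y \in T & y \notin L].
Proof.
move=> qM; have sylM := nonnormal_Sylow qM.
pose V := [group of gcore L T]; have nsVT : V <| T := gcore_normal sLT.
have sVL : V \subset L := gcore_sub L T.
have sylV := Sylow_setI_normal nsVT sylM.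
pose N := 'N_T(V :&: M)%G; have defT' : V * N = T := Frattini_arg nsVT sylV.
have not_sNL : ~~ (N \subset L).
  apply: contraL (maxgroupp maxL) => sNL.
  by rewrite -defT' properE mul_subG ?andbF.
have sNT : N \subset T := subsetIl _ _.
have sMN : M \subset N.
  by rewrite subsetI sMT normsI ?normG // (subset_trans sMT) ?normal_norm.
have sylN := pHall_subl sMN sNT sylM.
have not_sPL : ~~ (pres q N \subset L).
  by apply: contra not_sNL => sPL; rewrite -(pres_pgroup sylN) mul_subG.
have [y [r [Ny not_Ly r_pr neqr ry]]] := p'elt_notin not_sPL.
have Ty := subsetP sNT y Ny; split; last by exists y, r.
have sTN : T \subset N by rewrite -{1}(genT Ty not_Ly) join_subG sMN cycle_subG.
apply/trivgP; rewrite -coreM gcore_max ?subsetIl //.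
rewrite /= setIC; exact: subset_trans sTN (subsetIr _ _).
Qed.

(** Only [q] and [r] divide [#|T|], so [T = M <[y]>], and [y ^+ r] lies in the
    core [V] of [L]. Then [M V = L], and [M] is isomorphic to the core-free
    maximal subgroup [L / V] of [T / V], hence of prime order: a conjugate of [M]
    meets [M] in a maximal subgroup, and is maximal in [T]. *)
Lemma nonnormal_qgroup_max (q : nat) t :
  q.-group M -> t \in T -> M <*> M :^ t = T -> maximal M T.
Proof.
move=> qM Tt defTt.
have [tiMV [y [r [r_pr neqr ry Ty not_Ly]]]] := nonnormal_generator qM.
have defTy := genT Ty not_Ly.
have syT : <[y]> \subset T by rewrite cycle_subG.
have not_My : y \notin M by apply: contra not_Ly; apply: (subsetP sML).
have defL : L :=: M <*> <[y ^+ r]>.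
  have [L' [maxL' defL' _]] := modular_unique_max modM r_pr ry not_My defTy.
  have sL'T := proper_sub (maxgroupp maxL').
  have sL'L : L' \subset L.
    apply: contraTT (maxgroupp maxL') => not_sL'L.
    by rewrite [gval L'](uniqL _ sL'T) ?properxx // defL' joing_subl.
  rewrite -defL'; have [_ /(_ L sL'L sLT)[//|eqLT]] := maximal_overP _ _ maxL'.
  by have := maxgroupp maxL; rewrite eqLT properxx.
have tiMy : M :&: <[y]> = 1 by rewrite (diff_prime_TI _ qM ry) // eq_sym.
have r'M : ~~ (r %| #|M|).
  by rewrite -p'natE //; apply: (pi_pnat qM); rewrite !inE eq_sym.
(* The least overgroup of M has order |M| * r. *)
have nty : <[y]> != 1 by apply: contraNneq not_My => y1; rewrite -cycle_subG y1 sub1G.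
have [_ dvry _] := pgroup_pdiv ry nty.
have [z yz oz] := Cauchy r_pr dvry.
have szy : <[z]> \subset <[y]> by rewrite cycle_subG.
have szT := subset_trans szy syT.
pose M1 := (M <*> <[z]>)%G; have sM1T : M1 \subset T by rewrite join_subG sMT.
have maxM1 : maximal M M1.
  apply: (modular_maximal_join modM szT).
  have -> : M :&: <[z]> = 1 by apply/trivgP; rewrite -tiMy setIS.
  by apply: p_index_maximal; rewrite ?sub1G // indexg1 -orderE oz.
have sMM1 : M \subset M1 := joing_subl _ _.
have oM1 : #|M1| = (#|M| * r)%N.
  have pr1 := modular_maximal_index (modularS sMM1 sM1T modM) maxM1.
  have : r %| #|M1| by rewrite -oz orderE cardSg ?joing_subr.
  rewrite -(Lagrange sMM1) Euclid_dvdM // (negPf r'M) /= dvdn_prime2 //.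
  by move/eqP->.
have pi_T s : prime s -> s %| #|T| -> s != q -> s = r.
  move=> s_pr /(Cauchy s_pr)[w Tw ow] neqs.
  have s'M : ~~ (s %| #|M|).
    by rewrite -p'natE //; apply: (pi_pnat qM); rewrite !inE eq_sym.
  have not_Mw : w \notin M by apply: contra s'M => Mw; rewrite -ow orderE cardSg ?cycle_subG.
  have swT : <[w]> \subset T by rewrite cycle_subG.
  pose Z := (M <*> <[w]>)%G; have sMZ : M \subset Z := joing_subl _ _.
  have sZT : Z \subset T by rewrite join_subG sMT.
  have defZ : Z :=: M <*> (<[y]> :&: Z) by apply: (modular_overgroup modM syT); rewrite ?defTy.
  have ntyZ : <[y]> :&: Z != 1.
    apply: contra not_Mw => /eqP yZ1; rewrite -cycle_subG (subset_trans _ (_ : Z \subset M)) ?joing_subr //.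
    by rewrite defZ yZ1 joingG1.
  have zZ : z \in <[y]> :&: Z.
    exact: (@prime_elt_sub _ r y z (<[y]> :&: Z)%G r_pr ry yz oz (subsetIl _ _) ntyZ).
  have sM1Z : M1 \subset Z by rewrite join_subG sMZ cycle_subG; case/setIP: zZ.
  have defM1 : M1 :=: M <*> (<[w]> :&: M1) by apply: (modular_overgroup modM swT).
  have w_pr : prime #|<[w]>| by rewrite -orderE ow.
  have sw1 : <[w]> \subset M1.
    apply: contraTT (maxgroupp maxM1) => not_sw; rewrite defM1 prime_TIg //.
    by rewrite joingG1 properxx.
  have : s %| #|M1| by rewrite -ow orderE cardSg.
  by rewrite oM1 Euclid_dvdM // (negPf s'M) /= dvdn_prime2 // => /eqP.
have sylM := nonnormal_Sylow qM.
have sylX : r.-Sylow(T) <[y]>.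
  have [X sylX syX] := Sylow_superset syT ry.
  have sXT := pHall_sub sylX.
  have := modular_trace modM syX sXT; rewrite joingC defTy (setIidPr sXT) => <- //.
  by rewrite (diff_prime_TI _ qM (pHall_pgroup sylX)) ?sub1G // eq_sym.
have defMX : M * <[y]> = T.
  apply/eqP; rewrite eqEcard mul_subG //= TI_cardMg // (card_Hall sylM) (card_Hall sylX).
  rewrite -{1}(partnC q (cardG_gt0 T)) leq_mul2l; apply/orP; right.
  rewrite (@eq_in_partn _ r) // => s.
  rewrite mem_primes => /and3P[s_pr _ dvs]; rewrite !inE.
  by apply/idP/eqP=> [/pi_T-> // | ->].
pose V := [group of gcore L T]; have nsVT : V <| T := gcore_normal sLT.
have sVL : V \subset L := gcore_sub L T.
have nsVL : V <| L := normalS sVL sLT nsVT.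
have Vyr : y ^+ r \in V.
  apply/bigcapP=> t' ; rewrite -{1}defMX => /mulsgP[m w Mm yw ->].
  rewrite conjsgM (conjGid (subsetP sML m Mm)).
  have -> : y ^+ r = (y ^+ r) ^ w.
    have /cycleP[i ->] := yw.
    by apply/esym/conjg_fixP/commgP; apply: commuteX2.
  by rewrite memJ_conjg defL (subsetP (joing_subr _ _)) // cycle_id.
have nVL := normal_norm nsVL; have nVM := subset_trans sML nVL.
have eqLV : L / V = M / V.
  apply/eqP; rewrite eqEsubset (quotientS _ sML) andbT quotientSK //.
  rewrite -norm_joinEr // {1}defL join_subG joing_subr cycle_subG.
  by rewrite (subsetP (joing_subl _ _)).
have maxMV : maximal (M / V) (T / V) by rewrite -eqLV quotient_maximal.
have prM : prime #|M|.
  have := modular_maximal_struct (modular_quotient nsVT modM) maxMV.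
  rewrite /= -eqLV gcore_quotient1 // indexg1 => -[|_ prLV _ _].
    by apply: contra nnLT => nsL; rewrite -cosetpre_normal !quotientGK in nsL.
  suff -> : #|M| = #|L / V| by [].
  by rewrite eqLV (card_isog (quotient_isog nVM _)) // setIC.
pose Mt := (M :^ t)%G; have modMt : modular_subgroup T Mt := modularJ Tt modM.
have not_sMMt : ~~ (M \subset Mt).
  apply: contraL (maxgroupp maxL) => sMMt.
  have eqMMt : M :=: Mt by apply/eqP; rewrite eqEcard sMMt cardJg leqnn.
  have := defTt; rewrite -[M :^ t]eqMMt joingE setUid genGid => <-.
  by rewrite properE sML andbF.
have maxD : maximal (Mt :&: M) M.
  rewrite setIC prime_TIg //; apply: p_index_maximal; rewrite ?sub1G //.
  by rewrite indexg1.
have := modular_maximal_join modMt sMT maxD; rewrite joingC defTt.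
by rewrite -{1}(conjGid Tt) /Mt maximalJ.
Qed.

End NonNormalCase.

(** The dichotomy; the first alternative means that [M] is subnormal in [T]. *)
Theorem modular_cycle_dichotomy (gT : finGroupType) (T M : {group gT}) (p : nat) x :
    modular_subgroup T M -> prime p -> p.-elt x -> M <*> <[x]> = T ->
  pres p T \subset M \/ maximal M T.
Proof.
move: {2}_.+1 (ltnSn #|T|) => n.
elim: n => // n IHn in gT T M p x *; rewrite ltnS => leTn modM p_pr px defT.
suff core1 (aT : finGroupType) (U H : {group aT}) (y : aT) :
    #|U| <= n -> modular_subgroup U H -> p.-elt y -> H <*> <[y]> = U -> gcore H U = 1 ->
    pres p U \subset H \/ maximal H U.
  have sMT : M \subset T by case: modM.
  have sKM : gcore M T \subset M := gcore_sub M T.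
  have nsKT : gcore M T <| T by rewrite gcore_normal.
  have nsKM : gcore M T <| M by apply: normalS nsKT.
  have Tx : x \in T by rewrite -cycle_subG -defT joing_subr.
  have nKx : x \in 'N(gcore M T) := subsetP (normal_norm nsKT) x Tx.
  have := core1 _ (T / gcore M T)%G (M / gcore M T)%G (coset _ x).
  rewrite /= quotient_maximal // => -[|||||sP|]; last by right.
  - exact: leq_trans (leq_quotient _ _) leTn.
  - exact: modular_quotient.
  - exact: morph_p_elt.
  - rewrite -quotient_cycle // -quotientY ?defT ?cycle_subG //.
    by rewrite (subset_trans sMT) ?normal_norm.
  - exact: gcore_quotient1.
  left; apply: pres_sub_gen => z Tz p'z.
  have nKz : z \in 'N(gcore M T) := subsetP (normal_norm nsKT) z Tz.
  rewrite -(quotientGK nsKM) mem_morphpre //=; apply: (subsetP sP).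
  by apply: mem_pres; rewrite ?mem_quotient // morph_p_elt.
move=> {gT T M x leTn modM px defT}.
move=> leTn; move: aT U H y leTn => gT T M x leTn modM px defT coreM.
have [sMT m1 m2] := modM.
have sxT : <[x]> \subset T by rewrite -defT joing_subr.
have [Mx | not_Mx] := boolP (x \in M).
  left; rewrite -defT (joing_idPl _) ?cycle_subG //; exact: pres_sub.
have [L [maxL defL uniqL]] := modular_unique_max modM p_pr px not_Mx defT.
have [prLT maxL'] := maximal_overP _ _ maxL.
have [sLT ltLT] := (proper_sub prLT, proper_card prLT).
have sML : M \subset L by rewrite defL joing_subl.
have modML := modularS sML sLT modM.
have [nsLT | nnLT] := boolP (L <| T).
  left; apply: (dichotomy_normal_case modM p_pr px defT maxL) => //.
  apply: (IHn _ _ _ p (x ^+ p)); rewrite ?p_eltX //; exact: leq_trans leTn.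
have IH (T' M' : {group gT}) (r : nat) u :
    #|T'| < #|T| -> modular_subgroup T' M' -> prime r -> r.-elt u -> M' <*> <[u]> = T' ->
    pres r T' \subset M' \/ maximal M' T'.
  by move=> ltT'T; apply: IHn; exact: leq_trans leTn.
right; have [//|[q [t [_ qM Tt defTt]]]] :=
  nonnormal_pgroup modM defT coreM maxL sML uniqL nnLT IH.
exact: (nonnormal_qgroup_max modM coreM maxL sML uniqL nnLT qM Tt defTt).
Qed.

(** * Nilpotency modulo the core *)

Section Nilpotent.

Variables (gT : finGroupType) (G M : {group gT}).
Hypothesis modM : modular_subgroup G M.

Let sMG : M \subset G. Proof. by case: modM. Qed.

(** In the dichotomy for [T = <M, x>], either [M] and [T] have the same
    [p]-residual, or [M] is normal in [T], or [M / gcore M T] has prime order [q]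
    and [M] has the same [q]-residual as its core. *)
Lemma modular_norm_pres (p : nat) x :
    x \in G -> prime p -> p.-elt x ->
  exists2 q, prime q & x \in 'N(pres q M).
Proof.
move=> Gx p_pr px; pose T := (M <*> <[x]>)%G.
have sTG : T \subset G by rewrite join_subG sMG cycle_subG.
have sMT : M \subset T := joing_subl _ _.
have Tx : x \in T by rewrite (subsetP (joing_subr _ _)) ?cycle_id.
have modMT := modularS sMT sTG modM.
have [sPM | maxM] := modular_cycle_dichotomy modMT p_pr px (erefl _).
  exists p => //; rewrite (pres_eq sMT sPM).
  exact: (subsetP (normal_norm (pres_normal p T))).
have [nsM | nnM] := boolP (M <| T).
  by exists p => //; apply: (subsetP (norm_pres p M)); apply: (subsetP (normal_norm nsM)).
have [_ q_pr _ _] := modular_maximal_struct modMT maxM nnM.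
set q := #|M : _| in q_pr; exists q => //.
have nsDM : gcore M T <| M := normalS (gcore_sub M T) sMT (gcore_normal sMT).
have nDM := normal_norm nsDM.
have sPD : pres q M \subset gcore M T.
  by apply: pres_min => //; rewrite /pgroup card_quotient // pnat_id.
rewrite -(pres_eq (normal_sub nsDM) sPD); apply: (subsetP (norm_pres q _)).
exact: (subsetP (gcore_norm M T)).
Qed.

Lemma sub_conjg_join (y : gT) : M :^ y \subset M <*> <[y]>.
Proof.
have Jy : y \in M <*> <[y]> by rewrite (subsetP (joing_subr _ _)) ?cycle_id.
by rewrite -(conjGid Jy) conjSg joing_subl.
Qed.

(** For each prime [p] the constituent [g.`_p] normalises some residual of [M],
    which contains [R]; so [R :^ g] lies in [<M, g.`_p^'>]. The intersection of
    these subgroups over all [p] is [M]. *)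
Lemma modular_pres_conj (R : {group gT}) (g : gT) :
    g \in G -> R \subset M -> (forall q, prime q -> R \subset pres q M) ->
  R :^ g \subset M.
Proof.
move=> Gg sRM sRP; apply/subsetP=> w Rgw.
pose Z := (M <*> <[w]>)%G.
have sgG : <[g]> \subset G by rewrite cycle_subG.
have cG (pi : nat_pred) : g.`_pi \in G by apply: groupX.
have sMZ : M \subset Z := joing_subl _ _.
have sZg : Z \subset M <*> <[g]>.
  rewrite join_subG joing_subl cycle_subG /=.
  by apply: (subsetP (sub_conjg_join g)); apply: subsetP Rgw; rewrite conjSg.
have sZp (p : nat) : prime p -> Z \subset M <*> <[g.`_p^']>.
  move=> p_pr; rewrite join_subG joing_subl cycle_subG /=.
  have [q q_pr nPg] := modular_norm_pres (cG p) p_pr (p_elt_constt p g).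
  apply: (subsetP (sub_conjg_join _)).
  rewrite -{1}(consttC p g) conjsgM in Rgw.
  apply: (subsetP _ _ Rgw); rewrite conjSg.
  by apply: subset_trans (pres_sub q M); rewrite -(normP nPg) conjSg sRP.
suff sgM : <[g]> :&: Z \subset M.
  have := modular_overgroup modM sgG sMZ sZg; rewrite (joing_idPl sgM) => <-.
  by rewrite (subsetP (joing_subr _ _)) ?cycle_id.
apply/subsetP=> h /setIP[gh Zh].
rewrite -(prod_constt h); apply: group_prod => p _.
have [p_pr | npr] := boolP (prime p); last first.
  suff -> : h.`_p = 1 by [].
  apply/constt1P/pnatP=> // r r_pr _; apply/negP=> /eqP erp.
  by case/negP: npr; rewrite -erp.
have sg'g : <[g.`_p^']> \subset <[g]> by rewrite cycleX.
have [_ m1 _] := modM.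
have := m1 <[g.`_p^']>%G <[g]>%G sg'g sgG; rewrite [_ <*> M]joingC => eqJ.
have : h \in <[g.`_p^']> <*> (M :&: <[g]>).
  by rewrite eqJ inE gh (subsetP (sZp p p_pr)).
rewrite cent_joinEl; last first.
  have abg := cycle_abelian g.
  apply: subset_trans sg'g (subset_trans abg _).
  by rewrite centS ?subsetIr.
case/mulsgP=> a b g'a /setIP[Mb gb] ->.
have ga := subsetP sg'g a g'a.
rewrite consttM; last exact: (centsP (cycle_abelian g)).
have -> : a.`_p = 1.
  by apply/constt1P; apply: mem_p_elt g'a; apply: p_elt_constt.
by rewrite mul1g; apply: groupX.
Qed.

(** A late enough term of the lower central series of [M] lies in all the
    residuals of [M], since these have nilpotent quotients. *)
Lemma modular_corefree_nilpotent : gcore M G = 1 -> nilpotent M.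
Proof.
move=> core1; apply/lcnP; exists #|M|.
have sRM : 'L_#|M|.+1(M) \subset M by apply: lcn_sub.
apply/trivgP; rewrite -core1; apply/bigcapsP=> g Gg.
rewrite -sub_conjgV; apply: (@modular_pres_conj [group of 'L_#|M|.+1(M)]); rewrite ?groupV //.
move=> q q_pr; have nPM := normal_norm (pres_normal q M).
have nilQ := pgroup_nil (pres_quotient q M).
rewrite -quotient_sub1 ?(subset_trans sRM) //=.
have -> : 'L_#|M|.+1(M) / pres q M = 'L_#|M|.+1(M / pres q M) by apply: morphim_lcn.
suff -> : 'L_#|M|.+1(M / pres q M) = 1 by [].
apply/(lcn_nil_classP _ nilQ); have := nilQ; rewrite nilpotent_class => /ltnW le1.
exact: leq_trans le1 (leq_quotient _ _).
Qed.

End Nilpotent.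

(** * Coprime action on permutable subgroups *)

(** Variant of [coprime_cent_prod] where either group may be the solvable one. *)
Lemma coprime_sol_cent_prod (gT : finGroupType) (R A : {group gT}) :
    A \subset 'N(R) -> coprime #|R| #|A| -> solvable R || solvable A ->
  [~: R, A] * 'C_R(A) = R.
Proof.
move=> nRA coRA solA; have sRAR : [~: R, A] \subset R by rewrite commg_subl.
have nRAR : R \subset 'N([~: R, A]) := commg_norml R A.
have eqC : 'C_R(A) / [~: R, A] = 'C_(R / [~: R, A])(A / [~: R, A]).
  apply: strongest_coprime_quotient_cent; rewrite /= ?setIid ?commg_normr //.
    exact: coprimeSg coRA.
  by case/orP: solA => [/(solvableS sRAR)->|->]; rewrite ?orbT.
apply/eqP; rewrite eqEsubset mul_subG ?subsetIl //=.
rewrite -quotientSK // eqC subsetI subxx /=.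
by rewrite quotient_cents2 ?commg_normr.
Qed.

(** Variant of [coprime_commGid] where either group may be the solvable one. *)
Lemma coprime_sol_commGid (gT : finGroupType) (R A : {group gT}) :
    A \subset 'N(R) -> coprime #|R| #|A| -> solvable R || solvable A ->
  [~: R, A, A] = [~: R, A].
Proof.
move=> nRA coRA solA; apply/eqP; rewrite eqEsubset commSg ?commg_subl //=.
rewrite gen_subG; apply/subsetP=> _ /imset2P[x a Rx Aa ->].
rewrite -(coprime_sol_cent_prod nRA coRA solA) in Rx.
case/mulsgP: Rx => d c Dd /setIP[Rc cAc] ->.
have -> : [~ d * c, a] = [~ d, a] ^ c.
  have /eqP ca1 : [~ c, a] == 1 by apply/commgP; apply: (centP cAc).
  by rewrite commMgJ ca1 mulg1.
rewrite memJ_norm ?mem_commg //.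
have nRAc : c \in 'N([~: R, A]) by apply: (subsetP (commg_norml R A)).
have nAc : c \in 'N(A) by apply: (subsetP (cent_sub A)).
by rewrite -cycle_subG normsR ?cycle_subG.
Qed.

(** By induction on the order of [y]. Let [t = y ^+ q], and let [W] and [Wt] be
    generated by the conjugates of [H] under [<[y]>] and [<[t]>]. If [y] does not
    normalise [H], then [W] is a proper subgroup of [H <[y]>], so that
    [W = H Z] with [Z] contained in [<[t]>], and
    [R = [R, <[t]>] 'C_R(<[t]>)]. The second factor centralises [Z]; for the
    first one, [[W, [R, <[t]>]]] lies in [Wt], and by coprime action in the
    intersection of the conjugates of [H] under [<[t]>], which contains
    [[Wt, R]] by induction. Hence [[W, R]] lies in [H]; conjugation by [z]
    concludes. *)
Lemma permutable_coprime_comm (gT : finGroupType) (q : nat) (H R : {group gT}) y :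
    prime q -> q.-group H -> q^'.-group R -> R \subset 'N(H) ->
    q.-elt y -> y \in 'N(R) ->
    (forall z, z \in <[y]> -> commute (H : {set gT}) <[z]>) ->
  forall z, z \in <[y]> -> [~: H, R] \subset H :^ z.
Proof.
move=> q_pr qH q'R nHR.
move: {2}_.+1 (ltnSn #[y]) => n.
elim: n => // n IHn in y *; rewrite ltnS => leyn qy nRy permH.
have [nHy | not_nHy] := boolP (y \in 'N(H)).
  move=> z yz; have nHz : z \in 'N(H) by apply: subsetP yz; rewrite cycle_subG.
  by rewrite (normP nHz) commg_subl.
have nt_y : #[y] != 1%N.
  by rewrite order_eq1; apply: contraNneq not_nHy => ->; apply: group1.
have q_y : q %| #[y].
  have nt : <[y]> != 1 by rewrite cycle_eq1 -order_eq1.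
  by have [_ -> _] := pgroup_pdiv (qy : q.-group <[y]>) nt.
pose t := y ^+ q; have sty : <[t]> \subset <[y]> by apply: cycleX.
have ltty : #[t] < n.
  apply: leq_trans leyn; rewrite orderXdiv // ltn_Pdiv ?prime_gt1 ?order_gt0 //.
have IH : forall z, z \in <[t]> -> [~: H, R] \subset H :^ z.
  apply: IHn => //; rewrite ?p_eltX ?groupX // => z tz.
  by apply: permH; apply: (subsetP sty).
have sJ (z : gT) : z \in <[y]> -> H <*> <[z]> = H * <[z]>.
  by move=> yz; rewrite comm_joingE //; apply: permH.
have nRz z : z \in <[y]> -> R :^ z = R.
  by move=> yz; apply/normP; apply: subsetP yz; rewrite cycle_subG.
have nHzR z : z \in <[y]> -> R \subset 'N(H :^ z).
  by move=> yz; rewrite -(nRz z yz) normJ conjSg.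
pose T := (H <*> <[y]>)%G.
have qT : q.-group T by rewrite /= sJ ?cycle_id // pgroupM qH.
pose W := <<class_support H <[y]> >>%G; pose Wt := <<class_support H <[t]> >>%G.
pose J := (H <*> <[t]>)%G.
have sHW : H \subset W by rewrite sub_gen ?sub_class_support.
have sHWt : H \subset Wt by rewrite sub_gen ?sub_class_support.
have nWy : <[y]> \subset 'N(W) by rewrite norms_gen ?class_support_norm.
have nWtt : <[t]> \subset 'N(Wt) by rewrite norms_gen ?class_support_norm.
have sWT : W \subset T.
  rewrite gen_subG class_supportEr; apply/bigcupsP=> z yz.
  have Tz : z \in T by apply: (subsetP (joing_subr _ _)).
  by rewrite -(conjGid Tz) conjSg joing_subl.
have sWtJ : Wt \subset J.
  rewrite gen_subG class_supportEr; apply/bigcupsP=> z yz.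
  have Tz : z \in J by apply: (subsetP (joing_subr _ _)).
  by rewrite -(conjGid Tz) conjSg joing_subl.
have nWR : R \subset 'N(W).
  apply: norms_gen; rewrite class_supportEr; apply: norms_bigcup.
  by apply/bigcapsP=> z yz; apply: nHzR.
have nWtR : R \subset 'N(Wt).
  apply: norms_gen; rewrite class_supportEr; apply: norms_bigcup.
  by apply/bigcapsP=> z tz; apply: nHzR; apply: (subsetP sty).
have not_Wy : y \notin W.
  apply: contra not_nHy => Wy.
  have eqWT : W :=: T by apply/eqP; rewrite eqEsubset sWT join_subG sHW cycle_subG.
  have [eqHT | [N maxN sHN]] := maximal_exists (joing_subl H <[y]> : H \subset T).
    by apply: (subsetP (normG H)); rewrite eqHT (subsetP (joing_subr _ _)) ?cycle_id.
  have nsN := p_maximal_normal qT maxN.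
  have := maxgroupp maxN; rewrite properE -eqWT => /andP[_ /negP[]].
  rewrite gen_subG class_supportEr; apply/bigcupsP=> z yz.
  have Tz : z \in T by apply: (subsetP (joing_subr _ _)).
  by rewrite -(normP (subsetP (normal_norm nsN) z Tz)) conjSg.
pose Z := (<[y]> :&: W)%G.
have sZt : Z \subset <[t]>.
  by apply: cycle_proper_sub; rewrite ?subsetIl // inE negb_and not_Wy orbT.
have defW : H * Z = W.
  by rewrite /= group_modl // -sJ ?cycle_id // (setIidPr sWT).
have defW' : Z * H = W.
  by rewrite -[RHS]invGid -defW invMg !invGid.
have sWJ : W \subset J by rewrite -defW mul_subG ?joing_subl // (subset_trans sZt) ?joing_subr.
(* The core of H in J is the intersection of its conjugates under <[t]>. *)
pose Ht := [group of gcore H J].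
have ty : t \in <[y]> by apply: groupX; apply: cycle_id.
have sHRt : [~: H, R] \subset Ht.
  apply/bigcapsP=> g; rewrite /= sJ // => /mulsgP[h z Hh tz ->].
  by rewrite conjsgM (conjGid Hh) IH.
have eqHt : gcore H J = gcore H <[t]>.
  apply/eqP; rewrite eqEsubset; apply/andP; split; apply/bigcapsP=> g.
    by move=> tg; apply: bigcap_inf; apply: (subsetP (joing_subr _ _)).
  rewrite /= sJ // => /mulsgP[h z Hh tz ->].
  by rewrite conjsgM (conjGid Hh); apply: bigcap_inf.
have nHtR : R \subset 'N(Ht).
  rewrite /= eqHt; apply: norms_bigcap; apply/bigcapsP=> z tz.
  by apply: nHzR; apply: (subsetP sty).
have nHtJ : J \subset 'N(Ht) := gcore_norm H J.
have sHtH : Ht \subset H := gcore_sub H J.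
have nHtWt := subset_trans sWtJ nHtJ; have nHtW := subset_trans sWJ nHtJ.
have sWtRHt : [~: Wt, R] \subset Ht.
  rewrite -quotient_cents2 // sub_morphim_pre // gen_subG class_supportEr.
  apply/bigcupsP=> z tz; have Jz : z \in J by apply: (subsetP (joing_subr _ _)).
  have sHzJ : H :^ z \subset 'N(Ht).
    by apply: subset_trans nHtJ; rewrite -(conjGid Jz) conjSg joing_subl.
  rewrite -sub_morphim_pre // quotient_cents2 //.
  have yz := subsetP sty z tz.
  rewrite -{1}(nRz z yz) -conjsRg -(normP (subsetP nHtJ z Jz)) conjSg.
  exact: sHRt.
pose R2 := [group of [~: R, <[t]>]].
have nRt : <[t]> \subset 'N(R) by rewrite (subset_trans sty) ?cycle_subG.
have sR2R : R2 \subset R by rewrite commg_subl.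
have nWtW : W \subset 'N(Wt).
  rewrite -defW mul_subG ?(subset_trans sHWt) ?normG //.
  exact: subset_trans sZt nWtt.
have sWR2 : [~: W, R2] \subset Wt.
  have nR2 := subset_trans sR2R nWtR.
  rewrite -quotient_cents2 // centsC /= quotientR //.
  have ct : <[t]> / Wt \subset 'C(W / Wt).
    rewrite -defW quotientMl ?(subset_trans sHWt) ?normG //.
    rewrite (_ : H / Wt = 1) ?mul1g; last by apply/trivgP; rewrite quotient_sub1 ?(subset_trans sHWt) ?normG.
    rewrite quotient_cents //; apply: subset_trans (cycle_abelian t) _.
    exact: centS.
  apply: subset_trans (commgS _ ct) _; rewrite commg_subr.
  by rewrite norms_cent ?quotient_norms.
have sWR2t : [~: W, R2] \subset Ht.
  have qW : q.-group W := pgroupS sWT qT.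
  rewrite -(@coprime_sol_commGid _ W R2) ?(subset_trans sR2R) //.
  - by apply: subset_trans sWtRHt; apply: commgSS.
  - exact: (pnat_coprime qW (pgroupS sR2R q'R)).
  by rewrite (pgroup_sol qW).
have defR : R2 * 'C_R(<[t]>) = R.
  apply: coprime_sol_cent_prod => //; last by rewrite (abelian_sol (cycle_abelian t)) orbT.
  by rewrite coprime_sym; apply: (pnat_coprime (p_eltX q qy : q.-group <[t]>) q'R).
have sWR w e : w \in W -> e \in R -> [~ w, e] \in H.
  rewrite -defR => Ww /mulsgP[e2 e1 R2e2 /setIP[Re1 te1] ->].
  rewrite commgMJ groupM //; last first.
    rewrite memJ_norm ?(subsetP nHR) //.
    by apply: (subsetP sHtH); apply: (subsetP sWR2t); apply: mem_commg.
  rewrite -defW' in Ww; case/mulsgP: Ww => z h Zz Hh ->.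
  have /eqP ze1 : [~ z, e1] == 1.
    by apply/commgP; apply: commute_sym; apply: (centP te1); apply: (subsetP sZt).
  rewrite commMgJ ze1 conj1g mul1g.
  by rewrite (subsetP (_ : [~: H, R] \subset H)) ?commg_subl ?mem_commg.
move=> z yz; rewrite gen_subG; apply/subsetP=> _ /imset2P[h e Hh Re ->].
rewrite mem_conjg conjRg; apply: sWR.
  by rewrite memJ_norm ?(subsetP sHW) // groupV (subsetP nWy).
by rewrite -mem_conjg nRz.
Qed.

(** * Modular subgroups of prime power order *)

Lemma group_sub_union (gT : finGroupType) (A B1 B2 : {group gT}) :
  (forall x, x \in A -> x \in B1 \/ x \in B2) -> A \subset B1 \/ A \subset B2.
Proof.
move=> sAB; have [|/subsetPn[a Aa not_B1a]] := boolP (A \subset B1); first by left.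
right; apply/subsetP=> b Ab; case: (sAB b Ab) => // B1b.
have B2a : a \in B2 by case: (sAB a Aa) => //; rewrite (negPf not_B1a).
case: (sAB _ (groupM Aa Ab)) => [|B2ab]; first by rewrite groupMr // (negPf not_B1a).
by rewrite -(groupMl b B2a).
Qed.

Lemma maximal_above_exists (gT : finGroupType) (Q S : {group gT}) :
  Q \proper S -> exists2 V : {group gT}, maximal Q V & V \subset S.
Proof.
move=> prQS; have [V /mingroupP[prQV minV] sVS] :=
  @mingroup_exists _ (fun V => Q \proper V) S prQS.
exists V => //; apply/maximal_overP; split=> // Z sQZ sZV.
have [->|neQZ] := eqVneq (Q : {set gT}) Z; first by left.
by right; apply: minV; rewrite // properEneq neQZ.
Qed.

Section PrimePower.

Variables (gT : finGroupType) (G Q : {group gT}) (q : nat).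
Hypothesis modQ : modular_subgroup G Q.
Hypothesis q_pr : prime q.
Hypothesis qQ : q.-group Q.

Let sQG : Q \subset G. Proof. by case: modQ. Qed.

(** A subgroup of [G] is called bad when [Q] is maximal but not normal in it. *)
Definition bad (B : {set gT}) := [&& B \subset G, maximal Q B & ~~ (Q <| B)].

(** An element of prime power order that does not normalise [Q] generates a bad
    subgroup with [Q], except possibly when it is a [q]-element. *)
Lemma bad_cycle (p : nat) (x : gT) :
    prime p -> p.-elt x -> x \in G -> x \notin 'N(Q) ->
  bad (Q <*> <[x]>) \/ p = q /\ pres q (Q <*> <[x]>) \subset Q.
Proof.
move=> p_pr px Gx not_nQx; pose T := (Q <*> <[x]>)%G.
have sQT : Q \subset T := joing_subl _ _.
have Tx : x \in T by rewrite (subsetP (joing_subr _ _)) ?cycle_id.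
have sTG : T \subset G by rewrite join_subG sQG cycle_subG.
have nnQT : ~~ (Q <| T).
  by apply: contra not_nQx => /normal_norm/subsetP; apply.
have [sPQ | maxQ] := modular_cycle_dichotomy (modularS sQT sTG modQ) p_pr px (erefl _).
  right; have [eqpq | neqpq] := eqVneq p q; first by rewrite -eqpq.
  case/negP: nnQT; have <- : pres p T = Q; last exact: pres_normal.
  apply/eqP; rewrite eqEsubset sPQ; apply/subsetP=> y Qy.
  apply: mem_pres; first exact: (subsetP sQT).
  by apply: (pi_pnat (mem_p_elt qQ Qy)); rewrite !inE eq_sym.
by left; rewrite /bad -[Q <*> _]/(gval T) sTG maxQ.
Qed.

Section BadFacts.

Variable B : {group gT}.
Hypothesis badB : bad B.

Lemma bad_sub : B \subset G. Proof. by case/and3P: badB. Qed.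
Lemma bad_max : maximal Q B. Proof. by case/and3P: badB. Qed.
Lemma bad_nn : ~~ (Q <| B). Proof. by case/and3P: badB. Qed.
Lemma sub_bad : Q \subset B. Proof. exact: proper_sub (maxgroupp bad_max). Qed.

Lemma bad_norm : 'N_B(Q) = Q. Proof. exact: maximal_norm bad_max bad_nn. Qed.

Let modQB : modular_subgroup B Q := modularS sub_bad bad_sub modQ.

Lemma bad_index : #|Q : gcore Q B| = q.
Proof.
have [_ pr _ _] := modular_maximal_struct modQB bad_max bad_nn.
have dvq : q.-nat #|Q : gcore Q B| by apply: pnat_dvd qQ; apply: dvdn_indexg.
by have := pnatP _ (prime_gt0 pr) dvq _ pr (dvdnn _); rewrite inE => /eqP.
Qed.

Lemma bad_index_lt : prime #|B : Q| /\ q < #|B : Q|.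
Proof.
have [pr1 _ lt _] := modular_maximal_struct modQB bad_max bad_nn.
by rewrite bad_index in lt.
Qed.

Lemma bad_core_normal : gcore Q B <| B.
Proof. exact: gcore_normal sub_bad. Qed.

Lemma bad_core_max : maximal (gcore Q B) Q.
Proof. by apply: p_index_maximal; rewrite ?gcore_sub // bad_index. Qed.

Lemma bad_elt : exists2 x, x \in B & x \notin Q.
Proof. by apply/subsetPn; case/andP: (maxgroupp bad_max). Qed.

Section Elt.

Variable x : gT.
Hypotheses (Bx : x \in B) (not_Qx : x \notin Q).

Lemma bad_conj_max : maximal (Q :^ x) B.
Proof. by rewrite -(conjGid Bx) maximalJ bad_max. Qed.

Lemma bad_conj_sub : Q :^ x \subset B.
Proof. by rewrite -(conjGid Bx) conjSg sub_bad. Qed.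

Lemma bad_conj_nsub : ~~ (Q \subset Q :^ x).
Proof.
apply: contra not_Qx => sQQx; rewrite -bad_norm inE Bx; apply/normP/eqP.
by rewrite eq_sym eqEcard sQQx cardJg leqnn.
Qed.

Lemma bad_conjY : Q <*> Q :^ x = B.
Proof.
rewrite joingC; apply: (@maximal_join _ B (Q :^ x)%G Q bad_conj_max sub_bad).
exact: bad_conj_nsub.
Qed.

Lemma bad_conjI : Q :&: Q :^ x = gcore Q B.
Proof.
have sDI : gcore Q B \subset Q :&: Q :^ x.
  rewrite subsetI gcore_sub -(normP (subsetP (gcore_norm Q B) x Bx)) conjSg.
  exact: gcore_sub.
have [_ /(_ (Q :&: Q :^ x)%G sDI (subsetIl _ _))[//|/= eqQ]] := maximal_overP _ _ bad_core_max.
by case/negP: bad_conj_nsub; rewrite -{1}eqQ subsetIr.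
Qed.

Lemma bad_conj_norm : 'N_B(Q :^ x) = Q :^ x.
Proof. by rewrite -{1}(conjGid Bx) normJ -conjIg bad_norm. Qed.

(** The second modular law for [Q^x], as [<Q^x, V>] contains [<B, V>]: the
    conjugates of overgroups of [Q] are generated by [Q^x] and their trace
    on [V]. *)
Lemma bad_overgroup_conj (V W : {group gT}) :
    Q \subset V -> V \subset G -> Q \subset W -> W \subset B <*> V ->
  Q :^ x <*> (V :&: W :^ x) = W :^ x.
Proof.
move=> sQV sVG sQW sWJ; have Gx := subsetP bad_sub x Bx.
have [_ _ m2] := modularJ Gx modQ.
have sBJ : B \subset Q :^ x <*> V.
  by rewrite -bad_conjY join_subG joing_subl andbT (subset_trans sQV) ?joing_subr.
have sJ : B <*> V \subset Q :^ x <*> V by rewrite join_subG sBJ joing_subr.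
have sWxJ : W :^ x \subset Q :^ x <*> V.
  by rewrite -(conjGid (subsetP sBJ x Bx)) conjSg (subset_trans sWJ).
rewrite (m2 V (W :^ x)%G) ?(setIidPr sWxJ) ?conjSg //=.
rewrite -(conjGid Gx) conjSg (subset_trans sWJ) // join_subG bad_sub //.
Qed.

End Elt.

End BadFacts.

Lemma badI_norm B (V : {group gT}) : bad (B : {group gT}) -> Q <| V -> V :&: B = Q.
Proof.
move=> badB nsQV; have [_ maxB] := maximal_overP _ _ (bad_max badB).
have sQVB : Q \subset V :&: B by rewrite subsetI normal_sub ?sub_bad.
have [//|/=/setIidPr sBV] := maxB (V :&: B)%G sQVB (subsetIr _ _).
by case/negP: (bad_nn badB); apply: normalS nsQV => //; apply: sub_bad.
Qed.

(** Suppose that [Q] is maximal in a [q]-subgroup [V], and let [D] be the core of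
    [Q] in [B]. The trace [U] of [V^x] on [V] is not contained in [Q^x]; for a
    suitable element [a * v] of [V] outside [Q] and [U], the first modular law
    gives [V = <[a * v]> D], so that [V / D] is cyclic. However, neither of its
    subgroups [Q / D] and [U / D] contains the other. *)
Lemma bad_no_overgroup B (V : {group gT}) :
  bad (B : {group gT}) -> V \subset G -> q.-group V -> maximal Q V -> False.
Proof.
move=> badB sVG qV maxQV; have nsQV := p_maximal_normal qV maxQV.
have [x Bx not_Qx] := bad_elt badB; have Gx := subsetP (bad_sub badB) x Bx.
have VB := badI_norm badB nsQV; have sQV := normal_sub nsQV.
have VxB : V :^ x :&: B = Q :^ x by rewrite -{1}(conjGid Bx) -conjIg VB.
have defVx := bad_overgroup_conj badB Bx not_Qx sQV sVG sQV (joing_subr B V).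
have sQB := sub_bad badB; have sQxB := bad_conj_sub badB Bx.
pose U := (V :&: V :^ x)%G.
have not_sUQx : ~~ (U \subset Q :^ x).
  apply/negP=> sUQ; rewrite (joing_idPl sUQ) in defVx.
  by have := maxgroupp maxQV; rewrite -(conjsgK x V) -defVx conjsgK properxx.
have [v /setIP[Vv Vxv] not_Qxv] := subsetPn not_sUQx.
have nQv : v \in 'N(Q) := subsetP (normal_norm nsQV) v Vv.
have nQxv : v \in 'N(Q :^ x).
  by rewrite normJ; apply: subsetP Vxv; rewrite conjSg normal_norm.
have not_Qv : v \notin Q.
  by apply: contra not_Qxv => Qv; rewrite -VxB inE Vxv (subsetP sQB).
(* Q :^ x and its conjugate under a * v generate B, so <Q :^ x, a * v> contains V. *)
have [a Qa not_Qxa] := subsetPn (bad_conj_nsub badB Bx not_Qx).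
have Ba := subsetP sQB a Qa; have Va := subsetP sQV a Qa.
have nBv : B :^ v = B.
  by rewrite -(bad_conjY badB Bx not_Qx) conjYg (normP nQv) (normP nQxv).
pose A := (Q :^ x <*> <[a * v]>)%G.
have sBA : B \subset A.
  have sQxavB : (Q :^ x) :^ (a * v) \subset B.
    by rewrite conjsgM -nBv conjSg -(conjGid Ba) conjSg.
  have maxQx := bad_conj_max badB Bx.
  rewrite -(@maximal_join _ B (Q :^ x)%G ((Q :^ x)%G :^ (a * v))%G maxQx sQxavB).
    by rewrite join_subG joing_subl sub_conjg_join.
  apply: contra not_Qxa => sQQ; rewrite -(bad_conj_norm badB Bx) inE Ba.
  rewrite -(groupMr a nQxv); apply/normP/eqP.
  by rewrite eqEcard sQQ !cardJg leqnn.
have Av : v \in A.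
  rewrite -(groupMl v (subsetP sBA a Ba)); apply: (subsetP (joing_subr _ _)).
  exact: cycle_id.
have sVA : V \subset A.
  rewrite -(@maximal_join _ V Q <[v]>%G maxQV) ?cycle_subG //.
  by rewrite join_subG (subset_trans sQB) ?cycle_subG.
have Vav : a * v \in V by rewrite groupM.
have defV : V :=: <[a * v]> <*> gcore Q B.
  have [_ m1 _] := modularJ Gx modQ.
  have savV : <[a * v]> \subset V by rewrite cycle_subG.
  have := m1 <[a * v]>%G V savV sVG; rewrite /= [_ <*> Q :^ x]joingC (setIidPr sVA).
  rewrite -(setIidPl sQxB) -setIA [B :&: V]setIC VB setIC.
  by rewrite (bad_conjI badB Bx not_Qx).
have nDV : V \subset 'N(gcore Q B).
  rewrite defV join_subG normG andbT cycle_subG groupM //.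
    by apply: (subsetP (gcore_norm Q B)).
  by rewrite -(bad_conjI badB Bx not_Qx) -cycle_subG normsI ?cycle_subG.
have cycVD : cyclic (V / gcore Q B).
  rewrite defV quotientYidr ?quotient_cycle ?cycle_cyclic //.
    by apply: (subsetP nDV).
  by rewrite cycle_subG (subsetP nDV).
have sDQ := gcore_sub Q B.
have sDU : gcore Q B \subset U.
  rewrite -(bad_conjI badB Bx not_Qx) subsetI (subset_trans (subsetIl _ _)) //.
  by rewrite (subset_trans (subsetIr _ _)) ?conjSg.
have sUV : U \subset V := subsetIl _ _.
have := cyclic_pgroup_chain cycVD (quotient_pgroup _ qV) (quotientS _ sQV) (quotientS _ sUV).
rewrite (quotientSGK (subset_trans sQV nDV) sDU) (quotientSGK (subset_trans sUV nDV) sDQ).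
case/orP=> [sQU | sUQ].
  case/negP: (bad_conj_nsub badB Bx not_Qx).
  by rewrite -VxB subsetI sQB andbT (subset_trans sQU) ?subsetIr.
by case/negP: not_Qv; apply: (subsetP sUQ); rewrite inE Vv.
Qed.

Lemma bad_Sylow B : bad (B : {group gT}) -> q.-Sylow(G) Q.
Proof.
move=> badB; have [S sylS sQS] := Sylow_superset sQG qQ.
have [-> // | neQS] := eqVneq Q S.
have [|V maxQV sVS] := @maximal_above_exists _ Q S; first by rewrite properEneq neQS.
have sVG := subset_trans sVS (pHall_sub sylS).
by case: (bad_no_overgroup badB sVG (pgroupS sVS (pHall_pgroup sylS)) maxQV).
Qed.

(** Two bad subgroups [B1] and [B2] in which [Q] has different cores. *)
Section TwoBad.

Variables B1 B2 : {group gT}.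
Hypotheses (bad1 : bad B1) (bad2 : bad B2) (B12 : B1 :&: B2 = Q).
Hypothesis neqD : gcore Q B1 != gcore Q B2.

Let sQB1 := sub_bad bad1.
Let sQB2 := sub_bad bad2.

Lemma card_bad_core (B : {group gT}) : bad B -> (#|gcore Q B| * q)%N = #|Q|.
Proof. by move=> badB; rewrite -(bad_index badB) Lagrange ?gcore_sub. Qed.

Lemma bad_coreY : gcore Q B1 <*> gcore Q B2 = Q.
Proof.
apply: (maximal_join (bad_core_max bad1) (gcore_sub Q B2)).
apply: contra neqD => sD21; rewrite eq_sym eqEcard sD21 /=.
by rewrite -(leq_pmul2r (prime_gt0 q_pr)) !card_bad_core.
Qed.

(** The trace of [B^x] on [B2] has index [q] in [B2] for all these [B]. *)
Lemma two_bad_trace (x : gT) (B : {group gT}) :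
    x \in B1 -> x \notin Q -> Q \subset B -> B \subset B1 <*> B2 -> B :&: B1 = Q ->
    B :!=: Q ->
  (#|B2 :&: B :^ x| * q)%N = #|B2| /\ gcore Q B1 \subset B2 :&: B :^ x.
Proof.
move=> B1x not_Qx sQB sBJ BB1 neqBQ.
have sQxB1 := bad_conj_sub bad1 B1x.
have defBx := bad_overgroup_conj bad1 B1x not_Qx sQB2 (bad_sub bad2) sQB sBJ.
pose U := (B2 :&: B :^ x)%G.
have BxB1 : B :^ x :&: B1 = Q :^ x by rewrite -{1}(conjGid B1x) -conjIg BB1.
have UB1 : U :&: B1 = gcore Q B1.
  rewrite /= -setIA BxB1 -(bad_conjI bad1 B1x not_Qx).
  by rewrite -[X in _ = X :&: _]B12 [B1 :&: B2]setIC -setIA (setIidPr sQxB1).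
have sD1U : gcore Q B1 \subset U by rewrite -UB1 subsetIl.
split=> //; have not_sUQ : ~~ (U \subset Q).
  apply/negP=> sUQ; case/eqP: neqBQ.
  have eqU : U :=: gcore Q B1 by rewrite -UB1 (setIidPl (subset_trans sUQ sQB1)).
  apply: (@conjsg_inj _ x); rewrite -defBx /= -/(gval U) eqU; apply/joing_idPl.
  by rewrite -(bad_conjI bad1 B1x not_Qx) subsetIr.
have nD2 := normal_norm (bad_core_normal bad2).
have sUB2 : U \subset B2 := subsetIl _ _.
have defB2 : U * gcore Q B2 = B2.
  rewrite -norm_joinEl ?(subset_trans sUB2) //.
  have sUD2 : U <*> gcore Q B2 \subset B2.
    by rewrite join_subG sUB2 (subset_trans (gcore_sub Q B2)).
  have sQ : Q \subset U <*> gcore Q B2.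
    by rewrite -{1}bad_coreY genS ?setSU.
  have [_ /(_ (U <*> gcore Q B2)%G sQ sUD2)[/= eqQ|//]] := maximal_overP _ _ (bad_max bad2).
  by case/negP: not_sUQ; rewrite -eqQ joing_subl.
have UD2 : U :&: gcore Q B2 = gcore Q B1 :&: gcore Q B2.
  have sD2B1 := subset_trans (gcore_sub Q B2) sQB1.
  by rewrite -UB1 -(setIA (gval U) (gval B1)) (setIidPr sD2B1).
have c1 := mul_cardG U [group of gcore Q B2].
have c2 := mul_cardG [group of gcore Q B1] [group of gcore Q B2].
rewrite /= defB2 UD2 in c1.
have defQ : gcore Q B1 * gcore Q B2 = Q.
  rewrite -norm_joinEl ?bad_coreY // (subset_trans (gcore_sub Q B1)) //.
  exact: subset_trans sQB2 nD2.
rewrite /= defQ -(card_bad_core bad2) in c2.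
have e12 : #|gcore Q B1| = #|gcore Q B2|.
  by apply/eqP; rewrite -(eqn_pmul2r (prime_gt0 q_pr)) !card_bad_core.
have D2_gt0 := cardG_gt0 [group of gcore Q B2].
have e1 : #|gcore Q B1| = (q * #|gcore Q B1 :&: gcore Q B2|)%N.
  by apply/eqP; rewrite -(eqn_pmul2l D2_gt0) mulnC c2 mulnA.
apply/eqP; rewrite -(eqn_pmul2r D2_gt0) mulnAC c1 -mulnA [(_ * q)%N]mulnC -e1.
by rewrite e12.
Qed.

(** Applied to [B2] and [B3], the previous lemma yields two subgroups of index
    [q] in [B2] whose intersection is contained in the core of [Q] in [B1]; but
    [#|B2 : Q| > q] leaves no room for them. *)
Lemma two_bad_no_third (B3 : {group gT}) :
    Q \subset B3 -> B3 \subset B1 <*> B2 -> B3 :&: B1 = Q -> B3 :&: B2 = Q ->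
  B3 :=: Q.
Proof.
move=> sQB3 sB3J B31 B32; apply/eqP/idPn=> neqB3.
have [x B1x not_Qx] := bad_elt bad1.
have B21 : B2 :&: B1 = Q by rewrite setIC.
have neqB2 : B2 :!=: Q.
  by apply: contraTneq (maxgroupp (bad_max bad2)) => ->; rewrite properxx.
have [o2 _] := two_bad_trace B1x not_Qx sQB2 (joing_subr _ _) B21 neqB2.
have [o3 _] := two_bad_trace B1x not_Qx sQB3 sB3J B31 neqB3.
set U2 := B2 :&: B2 :^ x in o2; set U3 := B2 :&: B3 :^ x in o3.
have sI : U2 :&: U3 \subset gcore Q B1.
  rewrite -(bad_conjI bad1 B1x not_Qx) subsetI.
  have sIQx : U2 :&: U3 \subset Q :^ x by rewrite -B32 [B3 :&: _]setIC conjIg setISS ?subsetIr.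
  rewrite sIQx andbT -B12 subsetI (subset_trans sIQx) ?(bad_conj_sub bad1) //=.
  by rewrite (subset_trans (subsetIl _ _)) ?subsetIl.
have [_ ltqr] := bad_index_lt bad2.
have c := mul_cardG [group of U2] [group of U3]; rewrite /= in c.
have le1 : #|U2 * U3| <= #|B2| by rewrite subset_leq_card // mul_subG ?subsetIl.
have le2 : #|U2 :&: U3| <= #|gcore Q B1| := subset_leq_card sI.
have le3 : #|U2| * #|U3| <= #|U2| * (q * #|gcore Q B1|).
  by rewrite c mulnA o2 leq_mul.
move: le3; rewrite leq_pmul2l ?(cardG_gt0 [group of U2]) // => le3.
have : #|U3| * q <= #|Q| * q by rewrite leq_mul2r -(card_bad_core bad1) [(_ * q)%N]mulnC le3 orbT.
rewrite o3 -(Lagrange sQB2) leq_pmul2l ?cardG_gt0 //.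
by rewrite leqNgt ltqr.
Qed.

(** An element of prime power order of [<B1, B2>] outside [Q] generates with [Q]
    a subgroup that meets [B1] or [B2] in more than [Q], hence contains it, and
    is then equal to it. *)
Lemma two_bad_elt (w : gT) (p : nat) :
  prime p -> p.-elt w -> w \in B1 <*> B2 -> w \in B1 \/ w \in B2.
Proof.
move=> p_pr pw Jw; pose C := (Q <*> <[w]>)%G.
have sQC : Q \subset C := joing_subl _ _.
have Cw : w \in C by rewrite (subsetP (joing_subr _ _)) ?cycle_id.
have sCJ : C \subset B1 <*> B2.
  by rewrite join_subG cycle_subG Jw (subset_trans sQB1) ?joing_subl.
have sJG : B1 <*> B2 \subset G by rewrite join_subG !bad_sub.
have modC := modularS sQC (subset_trans sCJ sJG) modQ.
have inB (B : {group gT}) : bad B -> C :&: B != Q -> w \in B.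
  move=> badB neq; have sQB := sub_bad badB.
  have [_ maxB] := maximal_overP _ _ (bad_max badB).
  have sQCB : Q \subset C :&: B by rewrite subsetI sQC.
  have [eqQ|/=/setIidPr sBC] := maxB (C :&: B)%G sQCB (subsetIr _ _).
    by case/eqP: neq.
  have [sPQ | maxC] := modular_cycle_dichotomy modC p_pr pw (erefl _).
    case/negP: (bad_nn badB); apply: (pres_maximal_normal (bad_max badB)).
    exact: subset_trans (presS p sBC) sPQ.
  have [_ /(_ B sQB sBC)[eqBQ|->//]] := maximal_overP _ _ maxC.
  by have := maxgroupp (bad_max badB); rewrite eqBQ properxx.
have [C1|] := eqVneq (C :&: B1) Q; last by left; apply: inB.
have [C2|] := eqVneq (C :&: B2) Q; last by right; apply: inB.
by left; apply: (subsetP sQB1); rewrite -[gval Q](two_bad_no_third sQC sCJ C1 C2).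
Qed.

Lemma two_bad_conj (j : gT) :
  j \in B1 <*> B2 -> Q :^ j \subset B1 \/ Q :^ j \subset B2.
Proof.
move=> Jj; apply: (@group_sub_union _ (Q :^ j)%G) => x Qjx; apply: (two_bad_elt q_pr).
  by apply: (mem_p_elt _ Qjx); rewrite pgroupJ.
apply: subsetP Qjx; rewrite -(conjGid Jj) conjSg.
exact: subset_trans sQB1 (joing_subl _ _).
Qed.

End TwoBad.

(** A conjugate of [Q] under [B2] other than [Q] is not contained in [B1], nor
    are its conjugates under [B1]; so the latter lie in [B2], which is generated
    by such conjugates of [Q]. *)
Lemma two_bad_norm (B1 B2 : {group gT}) :
    bad B1 -> bad B2 -> B1 :&: B2 = Q ->
    (forall j, j \in B1 <*> B2 -> Q :^ j \subset B1 \/ Q :^ j \subset B2) ->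
  B1 \subset 'N(B2).
Proof.
move=> bad1 bad2 B12 conjB; have [sQB1 sQB2] := (sub_bad bad1, sub_bad bad2).
apply/subsetP=> x1 B1x; have [Qx | not_Qx] := boolP (x1 \in Q).
  by apply: (subsetP (normG B2)); apply: (subsetP sQB2).
have sub x2 : x2 \in B2 -> x2 \notin Q -> (Q :^ x2) :^ x1 \subset B2.
  move=> B2x not_Qx2; case: (conjB (x2 * x1)) => [||]; rewrite ?conjsgM //.
    by rewrite groupM ?(subsetP (joing_subl B1 B2) _ B1x) ?(subsetP (joing_subr B1 B2) _ B2x).
  move=> sQB; case/negP: not_Qx2; rewrite -(bad_norm bad2) inE B2x.
  suff sI : Q :^ x2 \subset B1 :&: B2.
    by rewrite B12 in sI; apply/normP/eqP; rewrite eqEcard cardJg leqnn andbT.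
  by rewrite subsetI (bad_conj_sub bad2) // andbT -(conjSg _ _ x1) (conjGid B1x).
have [x2 B2x not_Qx2] := bad_elt bad2.
have [a Qa not_Qxa] := subsetPn (bad_conj_nsub bad2 B2x not_Qx2).
have B2a := subsetP sQB2 a Qa.
have maxQx := bad_conj_max bad2 B2x.
have sQxaB : Q :^ (x2 * a) \subset B2.
  by rewrite conjsgM -(conjGid B2a) conjSg (bad_conj_sub bad2).
have defB2 : Q :^ x2 <*> Q :^ (x2 * a) = B2.
  apply: (@maximal_join _ B2 (Q :^ x2)%G (Q :^ (x2 * a))%G maxQx sQxaB).
  apply: contra not_Qxa => sQQ; rewrite -(bad_conj_norm bad2 B2x) inE B2a.
  by apply/normP/eqP; rewrite -conjsgM eqEcard sQQ !cardJg leqnn.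
rewrite inE -{1}defB2 conjYg join_subG !sub //; first by rewrite groupM.
by rewrite groupMr.
Qed.

(** [Q] has the same core in all bad subgroups: otherwise [B1] and [B2]
    normalise each other, and [Q = B1 :&: B2] is normal in [B1]. *)
Lemma bad_core_eq (B1 B2 : {group gT}) :
  bad B1 -> bad B2 -> gcore Q B1 = gcore Q B2.
Proof.
move=> bad1 bad2; apply/eqP/idPn=> neqD.
have [sQB1 sQB2] := (sub_bad bad1, sub_bad bad2).
have B12 : B1 :&: B2 = Q.
  have [_ max1] := maximal_overP _ _ (bad_max bad1).
  have sQI : Q \subset B1 :&: B2 by rewrite subsetI sQB1.
  have [//|/=/setIidPl sB12] := max1 (B1 :&: B2)%G sQI (subsetIl _ _).
  have [_ /(_ B1 sQB1 sB12)[eqQ|eqB]] := maximal_overP _ _ (bad_max bad2).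
    by have := maxgroupp (bad_max bad1); rewrite eqQ properxx.
  by rewrite eqB eqxx in neqD.
have conjB := two_bad_conj bad1 bad2 B12 neqD.
have nB2 := two_bad_norm bad1 bad2 B12 conjB.
have nB1 : B2 \subset 'N(B1).
  apply: two_bad_norm => //; first by rewrite setIC.
  by move=> j; rewrite joingC => /conjB[]; [right | left].
case/negP: (bad_nn bad1); rewrite /normal sQB1 -{1}B12.
by rewrite normsI ?normG.
Qed.

(** From now on [Q] is core-free in [G] and a bad subgroup exists. *)
Section NonNormalised.

Variable B : {group gT}.
Hypothesis badB : bad B.
Hypothesis coreQ : gcore Q G = 1.

(** An element of prime power order normalises the common core: either it
    normalises [Q], and permutes the bad subgroups, or it lies in a bad subgroup,
    the remaining possibility being excluded since [Q] is a Sylow subgroup. *)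
Lemma bad_core_trivial : gcore Q B = 1.
Proof.
apply/trivgP; rewrite -coreQ gcore_max ?gcore_sub //.
apply: pelt_gen_sub => x p p_pr px Gx.
have normal_case : x \in 'N(Q) -> x \in 'N(gcore Q B).
  move=> nQx; have badBx : bad (B :^ x)%G.
    rewrite /bad -{1}(conjGid Gx) conjSg (bad_sub badB) -{1 2}(normP nQx) maximalJ.
    by rewrite normalJ (bad_max badB) (bad_nn badB).
  rewrite inE {2}(bad_core_eq badB badBx) gcore_max //.
    by rewrite -{2}(normP nQx) conjSg gcore_sub.
  by rewrite normJ conjSg gcore_norm.
have [/normal_case // | not_nQx] := boolP (x \in 'N(Q)).
have Tx : x \in Q <*> <[x]> by rewrite (subsetP (joing_subr _ _)) ?cycle_id.
have [badT | [eqpq sPQ]] := bad_cycle p_pr px Gx not_nQx.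
  by rewrite /= (bad_core_eq badB badT) (subsetP (gcore_norm Q _)).
pose T := (Q <*> <[x]>)%G; have sQT : Q \subset T := joing_subl _ _.
have qT : q.-group T.
  have := pres_quotient q T; rewrite /pgroup card_quotient ?normal_norm ?pres_normal //.
  rewrite -(Lagrange (pres_sub q T)) pnatM => ->; rewrite andbT.
  exact: pgroupS sPQ qQ.
case/negP: not_nQx; apply: (subsetP (normG Q)).
have sTG : T \subset G by rewrite join_subG sQG cycle_subG.
by rewrite -[gval Q](sub_pHall (bad_Sylow badB) qT sQT sTG).
Qed.

Lemma card_bad : #|Q| = q.
Proof. by rewrite -(bad_index badB) bad_core_trivial indexg1. Qed.

(** Let [V = 'N_G(Q)] and [U = V :&: V^x]. Then [V = Q U], and [U] normalises [B],
    hence the normal subgroup [R] of prime order of [B = R Q]. So [[U, Q]]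
    centralises [R], and lies in ['C_Q(R)], which is trivial. *)
Lemma bad_norm_cent : 'N_G(Q) \subset 'C(Q).
Proof.
have [x Bx not_Qx] := bad_elt badB; have Gx := subsetP (bad_sub badB) x Bx.
have modQB := modularS (sub_bad badB) (bad_sub badB) modQ.
pose V := 'N_G(Q)%G; have sVG : V \subset G := subsetIl _ _.
have nsQV : Q <| V by rewrite /normal subsetI sQG normG subsetIr.
have VB := badI_norm badB nsQV; have sQV := normal_sub nsQV.
have VxB : V :^ x :&: B = Q :^ x by rewrite -{1}(conjGid Bx) -conjIg VB.
have defVx := bad_overgroup_conj badB Bx not_Qx sQV sVG sQV (joing_subr B V).
have sQB := sub_bad badB; have sQxB := bad_conj_sub badB Bx.
pose U := (V :&: V :^ x)%G.
have nQU : U \subset 'N(Q) by rewrite (subset_trans (subsetIl _ _)) ?normal_norm.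
have nQxU : U \subset 'N(Q :^ x).
  by rewrite (subset_trans (subsetIr _ _)) // normJ conjSg normal_norm.
have QQx : Q :&: Q :^ x = 1 by rewrite (bad_conjI badB) // bad_core_trivial.
have QU : Q :&: U = 1.
  apply/trivgP; rewrite -QQx subsetI subsetIl -VxB subsetI /= setIA subsetIr.
  by rewrite -setIA (subset_trans (subsetIl _ _)).
have defV : Q * U = V.
  apply/eqP; rewrite eqEcard mul_subG ?subsetIl //= TI_cardMg //.
  rewrite -(cardJg V x) -defVx /= norm_joinEr //.
  have := mul_cardG (Q :^ x)%G U; rewrite /= cardJg => ->.
  by rewrite leq_pmulr ?(cardG_gt0 (Q :^ x :&: U)).
have [r_pr ltqr] := bad_index_lt badB; set r := #|B : Q| in r_pr ltqr.
have [_ _ _ [R [nsRB _ RQ oR]]] := modular_maximal_struct modQB (bad_max badB) (bad_nn badB).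
rewrite bad_core_trivial indexg1 in RQ oR.
have nBU : U \subset 'N(B).
  by rewrite -(bad_conjY badB Bx not_Qx) normsY.
have sylR : r.-Sylow(B) R.
  rewrite pHallE normal_sub //= oR -(Lagrange sQB) partnM ?cardG_gt0 // card_bad.
  rewrite part_p'nat ?mul1n ?part_pnat_id ?pnat_id //.
  by rewrite p'natE // dvdn_prime2 // gtn_eqF.
have nRU : U \subset 'N(R).
  rewrite -(normal_Hall_pcore sylR nsRB).
  exact: char_norm_trans (pcore_char r B) nBU.
have nRQ : Q \subset 'N(R) := subset_trans sQB (normal_norm nsRB).
have pr_R : prime #|R| by rewrite oR.
have CQR : Q :&: 'C(R) = 1.
  rewrite prime_TIg ?card_bad //; apply/negP; rewrite centsC => cRQ.
  have : R \subset Q.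
    by rewrite -(bad_norm badB) subsetI (normal_sub nsRB) cents_norm.
  by move/setIidPl; rewrite RQ => R1; rewrite -R1 cards1 in pr_R.
have cUQ : U \subset 'C(Q).
  apply/commG1P/trivgP; rewrite -CQR subsetI commg_subr nQU.
  exact: norm_cyclic_commg_cent (prime_cyclic pr_R) nRU nRQ.
have -> : 'N_G(Q) = Q * U by rewrite defV.
rewrite mul_subG //.
by rewrite -abelianE cyclic_abelian // prime_cyclic // card_bad.
Qed.

(** The normal closure of [Q] is then contained in [P * Q], where [P = [L, Q]]
for a normal [q]-complement [L]: since [Q :&: L = 1], the subgroup [Q] and all
its conjugates normalise every subgroup of [L]. *)
Lemma bad_structure :
  exists P : {group gT},
    [/\ q^'.-group P, P \subset G,
        forall X : {group gT}, X \subset P -> X <| G,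
        'C_P(Q) = 1 & normal_closure G Q \subset P * Q].
Proof.
have [L [nsLG q'L defG]] := Burnside_transfer (bad_Sylow badB) bad_norm_cent.
have [sLG nLG] := andP nsLG; have nLQ := subset_trans sQG nLG.
have QL : Q :&: L = 1 by rewrite coprime_TIg // (pnat_coprime qQ).
have nXQ (X : {group gT}) : X \subset L -> Q \subset 'N(X).
  move=> sXL; have <- : (X <*> Q) :&: L = X.
    by rewrite (modular_trace modQ) // QL sub1G.
  by rewrite normsI // (subset_trans (joing_subr X Q)) ?normG.
pose W := <<class_support Q G>>%G.
have nXW (X : {group gT}) : X \subset L -> W \subset 'N(X).
  move=> sXL; rewrite gen_subG class_supportEr; apply/bigcupsP=> g Gg.
  rewrite sub_conjg -normJ.
  by apply: (nXQ (X :^ g^-1)%G); rewrite /= sub_conjgV (normsP nLG).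
have sQW : Q \subset W by rewrite sub_gen // sub_class_support.
have nWL : L \subset 'N(W) by apply: subset_trans sLG _; rewrite norms_gen ?class_support_norm.
have coLQ : coprime #|L| #|Q| by rewrite coprime_sym (pnat_coprime qQ).
have solQ : solvable L || solvable Q by rewrite (pgroup_sol qQ) orbT.
pose P := [~: L, Q]%G; have sPL : P \subset L by rewrite /= commg_subl.
have sPW : P \subset W.
  by apply: subset_trans (commgS _ sQW) _; rewrite commg_subr.
have PQ : [~: P, Q] = P := coprime_sol_commGid nLQ coLQ solQ.
have cPL : P \subset 'C(L).
  rewrite centsC; apply/subsetP=> x Lx; rewrite -cycle_subG centsC -PQ.
  have nx : W \subset 'N(<[x]>) by apply: nXW; rewrite cycle_subG.
  by apply: norm_cyclic_commg_cent; rewrite ?cycle_cyclic // (subset_trans _ nx).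
have nPQ : Q \subset 'N(P) by apply: nXQ.
exists P; split; first exact: pgroupS sPL q'L.
- exact: subset_trans sPL sLG.
- move=> X sXP; rewrite /normal (subset_trans sXP) ?(subset_trans sPL) //=.
  rewrite -defG mul_subG ?(nXQ _ (subset_trans sXP sPL)) //.
  by rewrite cents_norm // centsC (subset_trans sXP).
- rewrite -PQ; apply: coprime_abel_cent_TI => //.
    by rewrite (coprimeSg sPL).
  exact: subset_trans cPL (centS sPL).
rewrite -norm_joinEr // gen_subG class_supportEr; apply/bigcupsP=> g.
rewrite -defG => /mulsgP[l a Ll Qa ->]; apply/subsetP=> _ /imsetP[b Qb ->].
rewrite conjgM memJ_norm; last by rewrite (subsetP (normG _)) // mem_gen // inE Qa orbT.
rewrite conjg_mulR groupM ?mem_gen //; first by rewrite inE Qb orbT.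
by rewrite inE -[_ \in P]groupV invg_comm mem_commg.
Qed.

End NonNormalised.

End PrimePower.

(** * Chief factors *)

Section Chief.

Variables (gT : finGroupType) (G : {group gT}).
Implicit Types A B C H K L N Z : {group gT}.

Lemma chief_maxP K H :
  reflect [/\ K <| G, H <| G, K \proper H &
              forall L : {group gT}, L <| G -> K \subset L -> L \subset H ->
                L :=: K \/ L :=: H]
          (chief_factor G K H).
Proof.
apply: (iffP andP) => [[/maxgroupP[/andP[prKH nKG] maxK] nsHG] | [nsKG nsHG prKH maxK]].
  split=> // [|L nsLG sKL sLH].
    by rewrite /normal nKG (subset_trans (proper_sub prKH)) ?normal_sub.
  have [->|neqLH] := eqVneq (L : {set gT}) H; first by right.
  by left; apply: maxK; rewrite // properEneq neqLH sLH normal_norm.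
split=> //; apply/maxgroupP; rewrite prKH normal_norm //; split=> // L.
case/andP=> prLH nLG sKL; have sLH := proper_sub prLH.
have nsLG : L <| G by rewrite /normal nLG (subset_trans sLH) ?normal_sub.
by case: (maxK L nsLG sKL sLH) => // eqLH; rewrite eqLH properxx in prLH.
Qed.

(** A normal subgroup [N] either covers a chief factor [H / K], which is then
    isomorphic to a chief factor below [N], ... *)
Lemma chief_covered N K H :
    N <| G -> chief_factor G K H -> ~~ (H :&: N \subset K) ->
  chief_factor G (K :&: N) (H :&: N) /\ H / K \isog (H :&: N) / (K :&: N).
Proof.
move=> nsNG /chief_maxP[nsKG nsHG prKH maxK] not_sK.
have [sKH sHG] := (proper_sub prKH, normal_sub nsHG).
have nKH := subset_trans sHG (normal_norm nsKG).
have nK L : L <| G -> L \subset 'N(K).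
  by move=> nsLG; apply: subset_trans (normal_sub nsLG) (normal_norm nsKG).
split; last first.
  have nsIG : (H :&: N)%G <| G by rewrite normalI.
  have [|eqK|eqH] := maxK (K <*> (H :&: N))%G (normalY nsKG nsIG) (joing_subl _ _).
  - by rewrite join_subG sKH subsetIl.
  - by case/negP: not_sK; rewrite -eqK joing_subr.
  rewrite -{1}eqH /= quotientYidl ?nK // isog_sym.
  by have := second_isog (nK _ nsIG); rewrite /= setIA (setIidPl sKH).
apply/chief_maxP; split; rewrite ?normalI //=.
  rewrite properE (setSI _ sKH) /=.
  by apply: contra not_sK => sHN; apply: subset_trans sHN (subsetIl _ _).
move=> L nsLG /= sIL; rewrite subsetI => /andP[sLH sLN].
case: (maxK (K <*> L)%G (normalY nsKG nsLG) (joing_subl _ _)) => [|eqK|eqH].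
- by rewrite join_subG sKH.
- left; apply/eqP; rewrite eqEsubset sIL subsetI sLN andbT.
  by rewrite -eqK joing_subr.
right; rewrite -eqH /= norm_joinEr ?nK // setIC -group_modr // setIC.
exact/esym/mulSGid.
Qed.

(** ... or avoids it, and [H / K] is isomorphic to a chief factor above [N]. *)
Lemma chief_avoided N K H :
    N <| G -> chief_factor G K H -> H :&: N \subset K ->
  chief_factor G (K <*> N) (H <*> N) /\ H / K \isog (H <*> N) / (K <*> N).
Proof.
move=> nsNG /chief_maxP[nsKG nsHG prKH maxK] sIK.
have [sKH sHG] := (proper_sub prKH, normal_sub nsHG).
have nN L : L <| G -> L \subset 'N(N).
  by move=> nsLG; apply: subset_trans (normal_sub nsLG) (normal_norm nsNG).
have KNH : (K <*> N) :&: H = K.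
  by rewrite norm_joinEl ?nN // -group_modl // setIC mulGSid.
have nsKNG := normalY nsKG nsNG.
split; last first.
  have nKNH : H \subset 'N(K <*> N) := subset_trans sHG (normal_norm nsKNG).
  have defHN : H <*> N = (K <*> N) <*> H.
    by rewrite joingC [K <*> N]joingC -joingA (joing_idPr sKH).
  rewrite defHN quotientYidl // isog_sym.
  by have := second_isog nKNH; rewrite /= KNH isog_sym.
apply/chief_maxP; split; rewrite ?normalY //.
  rewrite properE join_subG joing_subr (subset_trans sKH) ?joing_subl //=.
  apply: contraL prKH => sHN; rewrite properE negb_and negbK.
  by rewrite -KNH subsetI (subset_trans _ sHN) ?joing_subl // subxx orbT.
move=> L nsLG /= sKNL sLHN; have sNL := subset_trans (joing_subr K N) sKNL.
have sKL := subset_trans (joing_subl K N) sKNL.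
have defL : L :=: (H :&: L) <*> N.
  have nsHL : (H :&: L)%G <| G by rewrite normalI.
  rewrite (norm_joinEl (nN _ nsHL)) /= setIC group_modr //.
  by apply/esym/setIidPl; rewrite -norm_joinEl ?nN.
case: (maxK (H :&: L)%G (normalI nsHG nsLG)) => [||eqK|eqH].
- by rewrite subsetI sKH.
- exact: subsetIl.
- by left; rewrite defL /= eqK.
by right; rewrite defL /= eqH.
Qed.

(** All the chief factors of [G] between [A] and [B] are cyclic. *)
Definition cyclic_factors (A B : {set gT}) :=
  forall K H, chief_factor G K H -> A \subset K -> H \subset B -> cyclic (H / K).

Lemma cyclic_factors_avoided A B K H :
    A <| G -> cyclic_factors A B -> chief_factor G K H ->
    H :&: A \subset K -> H <*> A \subset B ->
  cyclic (H / K).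
Proof.
move=> nsAG cycAB chHK sIK sHAB; have [chHA iso] := chief_avoided nsAG chHK sIK.
by rewrite (isog_cyclic iso); apply: cycAB chHA _ _; rewrite ?joing_subr.
Qed.

Lemma cyclic_factors_trans A B C :
    B <| G -> A \subset B -> B \subset C -> cyclic_factors A B -> cyclic_factors B C ->
  cyclic_factors A C.
Proof.
move=> nsBG sAB sBC cycAB cycBC K H chHK sAK sHC.
have [sHBK | not_sHBK] := boolP (H :&: B \subset K).
  by apply: cyclic_factors_avoided cycBC chHK sHBK _; rewrite // join_subG sHC.
have [chHB iso] := chief_covered nsBG chHK not_sHBK; rewrite (isog_cyclic iso).
by apply: cycAB chHB _ _; rewrite ?subsetIr // subsetI sAK.
Qed.

Lemma cyclic_factors_joing A B :
    A <| G -> B <| G -> cyclic_factors 1 A -> cyclic_factors 1 B ->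
  cyclic_factors 1 (A <*> B).
Proof.
move=> nsAG nsBG cycA cycB.
apply: (cyclic_factors_trans nsAG (sub1G A) (joing_subl A B) cycA) => K H chHK sAK sHAB.
have [sHBK | not_sHBK] := boolP (H :&: B \subset K); last first.
  have [chHB iso] := chief_covered nsBG chHK not_sHBK; rewrite (isog_cyclic iso).
  by apply: cycB chHB _ _; rewrite ?subsetIr ?sub1G.
have [_ _ /andP[sKH /negP not_sHK] _] := chief_maxP _ _ chHK; case: not_sHK.
have nAB : B \subset 'N(A) := subset_trans (normal_sub nsBG) (normal_norm nsAG).
have sAH := subset_trans sAK sKH.
have -> : H :=: A * (B :&: H) by rewrite group_modl // -norm_joinEr // (setIidPr sHAB).
by rewrite mul_subG // setIC.
Qed.

Lemma cyclic_factors_normal B :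
  (forall X : {group gT}, X \subset B -> X <| G) -> cyclic_factors 1 B.
Proof.
move=> nsB K H /chief_maxP[nsKG nsHG prKH maxK] _ sHB.
have [sKH [x Hx not_Kx]] := properP prKH.
have nsxG : <[x]>%G <| G by apply: nsB; rewrite cycle_subG (subsetP sHB).
have nKx : <[x]> \subset 'N(K) := subset_trans (normal_sub nsxG) (normal_norm nsKG).
case: (maxK (K <*> <[x]>)%G (normalY nsKG nsxG) (joing_subl _ _)) => [|eqK|eqH].
- by rewrite join_subG sKH cycle_subG.
- by case/negP: not_Kx; rewrite -eqK (subsetP (joing_subr _ _)) ?cycle_id.
by rewrite -eqH /= quotientYidl // quotient_cyclic ?cycle_cyclic.
Qed.

Lemma cyclic_factors_quotient_cyclic A B :
  A <| G -> cyclic (B / A) -> cyclic_factors A B.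
Proof.
move=> nsAG cycBA K H /chief_maxP[nsKG nsHG /proper_sub sKH _] sAK sHB.
have nA := normal_norm nsAG.
have nsAH : A <| H by rewrite (normalS (subset_trans sAK sKH) (normal_sub nsHG)).
have nsAK : A <| K by rewrite (normalS sAK (normal_sub nsKG)).
rewrite -(isog_cyclic (third_isog sAK nsAH (normalS sKH (normal_sub nsHG) nsKG))).
by rewrite quotient_cyclic // (cyclicS _ cycBA) ?quotientS.
Qed.

End Chief.

Lemma cyclic_factors_lift (gT : finGroupType) (G D Z : {group gT}) :
    D <| G -> D \subset Z -> cyclic_factors (G / D) 1 (Z / D) ->
  cyclic_factors G D Z.
Proof.
move=> nsDG sDZ cycZ K H /chief_maxP[nsKG nsHG prKH maxK] sDK sHZ.
have [sKH sHG] := (proper_sub prKH, normal_sub nsHG).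
have nsDH : D <| H by rewrite (normalS (subset_trans sDK sKH) sHG).
have nDH := normal_norm nsDH.
rewrite -(isog_cyclic (third_isog sDK nsDH (normalS sKH sHG nsKG))).
apply: cycZ; rewrite ?sub1G ?quotientS //; apply/chief_maxP.
split; rewrite ?quotient_normal ?quotient_proper //.
  by rewrite (normalS sDK sKH).
move=> L' /(inv_quotientN nsDG)[L defL sDL nsLG].
have nDL := subset_trans (normal_sub nsLG) (normal_norm nsDG).
have nDK := subset_trans (normal_sub nsKG) (normal_norm nsDG).
rewrite defL (quotientSGK nDK sDL) (quotientSGK nDL (subset_trans sDK sKH)).
by move=> sKL sLH; case: (maxK L nsLG sKL sLH) => ->; [left | right].
Qed.

Lemma normal_closure_normal (gT : finGroupType) (G Q : {group gT}) :
  Q \subset G -> <<class_support Q G>>%G <| G.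
Proof.
move=> sQG; rewrite /normal gen_subG norms_gen ?class_support_norm // andbT.
by rewrite class_supportEr; apply/bigcupsP=> g Gg; rewrite -(conjGid Gg) conjSg.
Qed.

Lemma normal_closure_sub (gT : finGroupType) (G Q Z : {group gT}) :
  Z <| G -> Q \subset Z -> normal_closure G Q \subset Z.
Proof.
move=> nsZG sQZ; rewrite gen_subG class_supportEr; apply/bigcupsP=> g Gg.
by rewrite -(normsP (normal_norm nsZG) g Gg) conjSg.
Qed.

Lemma sub_normal_closure (gT : finGroupType) (G Q : {group gT}) :
  Q \subset normal_closure G Q.
Proof. by rewrite sub_gen ?sub_class_support. Qed.

(** * The case of a residual that normalises [Q] *)

Section NormalisedCase.

Variables (gT : finGroupType) (G Q : {group gT}) (q : nat).
Hypotheses (q_pr : prime q) (qQ : q.-group Q) (sQG : Q \subset G).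
Hypothesis nQP : pres q G \subset 'N(Q).

Let nsKG : pres q G <| G := pres_normal q G.

(** [G = O^q(G) P], so that every conjugate of [Q] is a conjugate under [P]. *)
Lemma normalised_closure_pgroup (P : {group gT}) :
  q.-Sylow(G) P -> Q \subset P -> normal_closure G Q \subset P.
Proof.
move=> sylP sQP; rewrite gen_subG class_supportEr; apply/bigcupsP=> g.
rewrite -(pres_pgroup sylP) => /mulsgP[k a Kk Pa ->].
by rewrite conjsgM (normsP nQP k Kk) -(conjGid Pa) conjSg.
Qed.

Hypothesis coreQ : gcore Q G = 1.
Hypothesis permQ : forall y, y \in G -> q.-elt y -> commute (Q : {set gT}) <[y]>.

(** Coprime action: for a Sylow [r]-subgroup [R] of [K = O^q(G)] the commutator
[[Q, R]] lies in every conjugate of [Q], as these are the conjugates under a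
Sylow [q]-subgroup of [N(R)]. *)
Lemma normalised_pres_cent : pres q G \subset 'C(Q).
Proof.
apply/idPn=> /p'elt_notin[u [r [Gu not_Cu r_pr neqrq ru]]].
have q'r : r \in (q^')%N by rewrite !inE.
have Ku : u \in pres q G by apply: mem_pres => //; apply: (pi_pnat ru).
have sK : <[u]> \subset pres q G by rewrite cycle_subG.
have [R sylR suR] := @Sylow_superset r _ _ <[u]>%G sK ru.
case/negP: not_Cu; rewrite -cycle_subG (subset_trans suR) // centsC.
apply/commG1P/trivgP; rewrite -coreQ; apply/bigcapsP=> g Gg.
have [S sylS] := Sylow_exists q 'N_G(R).
have [sSNR qS _] := and3P sylS; have [sSG nRS] := subsetIP sSNR.
have defG : pres q G * S = G.
  apply/eqP; rewrite eqEsubset mul_subG ?pres_sub //=.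
  rewrite -{1}(Frattini_arg nsKG sylR) -(pres_pgroup sylS) mulgA.
  by rewrite mulSg // mul_subG // presS ?subsetIl.
rewrite -defG in Gg; have [k y Kk Sy ->] := mulsgP Gg.
rewrite conjsgM (normsP nQP k Kk).
apply: (@permutable_coprime_comm _ q Q R y _ _ _ _ _ _ _ y) => //; rewrite ?cycle_id //.
- exact: pi_pnat (pHall_pgroup sylR) q'r.
- exact: subset_trans (pHall_sub sylR) nQP.
- exact: mem_p_elt qS Sy.
- exact: (subsetP nRS).
move=> z yz; have Sz : z \in S by rewrite (subsetP _ z yz) ?cycle_subG.
by apply: permQ; [apply: (subsetP sSG) | apply: mem_p_elt qS Sz].
Qed.

(** [O^q(G)] centralises the [q]-group [Q^G], so a chief factor below it is a
    chief factor of a Sylow [q]-subgroup, hence central and of prime order. *)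
Lemma normalised_cyclic_factors : cyclic_factors G 1 (normal_closure G Q).
Proof.
move=> K H chHK _ sHW; have [nsKG' nsHG prKH maxK] := chief_maxP _ _ _ chHK.
have [P sylP sQP] := Sylow_superset sQG qQ.
have sHP := subset_trans sHW (normalised_closure_pgroup sylP sQP).
have sPG := pHall_sub sylP.
have cHP : pres q G \subset 'C(H).
  rewrite centsC (subset_trans sHW) // gen_subG class_supportEr.
  apply/bigcupsP=> g Gg; rewrite sub_conjg -centJ -(normsP (normal_norm nsKG) g Gg) conjsgK.
  by rewrite centsC normalised_pres_cent.
have nKG := normal_norm nsKG'; have sKH := proper_sub prKH.
have nilPK : nilpotent (P / K) := pgroup_nil (quotient_pgroup _ (pHall_pgroup sylP)).
have nsHPK : H / K <| P / K by rewrite quotient_normal ?(normalS sHP sPG).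
have ntHK : H / K != 1.
  by rewrite -subG1 quotient_sub1 ?proper_subn // (subset_trans (normal_sub nsHG)).
have /trivgPn[xb /setIP[Hxb /setIP[Pxb cPx]] ntx] := meet_center_nil nilPK nsHPK ntHK.
have nxG : G / K \subset 'N(<[xb]>).
  rewrite -(pres_pgroup sylP) quotientMl ?(subset_trans (pres_sub q G)) //.
  rewrite cents_norm // cent_cycle mul_subG // sub_cent1.
    by apply: (subsetP _ xb Hxb); rewrite centsC quotient_cents.
  exact: cPx.
have /mingroupP[_ minHK] := chief_factor_minnormal chHK.
have <- : <[xb]> = H / K.
  by apply: (minHK <[xb]>%G); rewrite ?cycle_subG // cycle_eq1 ntx.
exact: cycle_cyclic.
Qed.

End NormalisedCase.

(** * Sylow subgroups of core-free modular subgroups *)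

Section CoreFree.

Variables (gT : finGroupType) (G M : {group gT}) (q : nat).
Hypothesis modM : modular_subgroup G M.
Hypothesis core1 : gcore M G = 1.
Hypothesis q_pr : prime q.

Let Q := 'O_q(M)%G.
Let E := 'O_q^'(M)%G.

Let sMG : M \subset G. Proof. by case: modM. Qed.
Let sQM : Q \subset M := pcore_sub q M.
Let sEM : E \subset M := pcore_sub q^' M.
Let sQG : Q \subset G := subset_trans sQM sMG.
Let qQ : q.-group Q := pcore_pgroup q M.
Let q'E : q^'.-group E := pcore_pgroup q^' M.
Let nilM : nilpotent M := modular_corefree_nilpotent modM core1.

Let defM : Q \x E = M. Proof. exact: nilpotent_pcoreC. Qed.
Let mulM : Q * E = M. Proof. by have [] := dprodP defM. Qed.
Let cQE : E \subset 'C(Q). Proof. by have [] := dprodP defM. Qed.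

Lemma coreQ1 : gcore Q G = 1.
Proof.
apply/trivgP; rewrite -core1 gcore_max ?gcore_norm //.
exact: subset_trans (gcore_sub Q G) sQM.
Qed.

(** [E] is the [q]-residual of [M], and [Q] is characteristic in the other
    residuals. *)
Lemma pelt_normQE (p : nat) y :
  prime p -> p.-elt y -> y \in G -> y \in 'N(Q) \/ y \in 'N(E).
Proof.
move=> p_pr py Gy; have [s s_pr ny] := modular_norm_pres modM Gy p_pr py.
have hallE : q^'.-Hall(M) E := nilpotent_pcore_Hall q^' nilM.
have hallQ : q.-Hall(M) Q := nilpotent_pcore_Hall q nilM.
have [eqsq | neqsq] := eqVneq s q.
  right; suff <- : pres s M = E by [].
  apply/eqP; rewrite eqEsubset eqsq; apply/andP; split.
    by apply: pres_sub_gen => x Mx; rewrite (mem_normal_Hall hallE) ?pcore_normal.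
  apply/subsetP=> x Ex; apply: mem_pres; first exact: (subsetP sEM).
  exact: mem_p_elt q'E Ex.
left; have sQP : Q \subset pres s M.
  apply/subsetP=> x Qx; apply: mem_pres; first exact: (subsetP sQM).
  by apply: (pi_pnat (mem_p_elt qQ Qx)); rewrite !inE eq_sym.
have -> : gval Q = 'O_q(pres s M).
  apply/eqP; rewrite eqEsubset pcore_max //=; last first.
    by rewrite (normalS sQP (pres_sub s M)) ?pcore_normal.
  apply: pcore_max; first exact: pcore_pgroup.
  exact: char_normal_trans (pcore_char q _) (pres_normal s M).
by apply: subsetP ny; apply: char_norm_trans (pcore_char q _) _.
Qed.

(** Each Sylow subgroup of [G] is contained in one of the two normalisers. *)
Lemma mul_normQE : 'N_G(Q) * 'N_G(E) = G.
Proof.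
apply: coprime_index_mulG; rewrite ?subsetIl //.
rewrite coprime_has_primes ?indexg_gt0 //; apply/hasPn=> r.
rewrite mem_primes => /and3P[r_pr _ dv2]; rewrite mem_primes r_pr indexg_gt0 /=.
apply/negP=> dv1; have [R sylR] := Sylow_exists r G.
have [sRG rR r'R] := and3P sylR.
have r'N (N : {group gT}) : R \subset 'N(N) -> r %| #|G : 'N_G(N)| -> False.
  move=> nNR dv; have : ~~ (r %| #|G : R|) by rewrite -p'natE.
  by case/negP; apply: dvdn_trans dv (indexgS G _); rewrite subsetI sRG.
have [|nR|nR] := @group_sub_union _ R 'N(Q)%G 'N(E)%G; last 2 first.
- exact: r'N nR dv1.
- exact: r'N nR dv2.
move=> x Rx; apply: (pelt_normQE r_pr); [apply: mem_p_elt rR Rx | exact: (subsetP sRG)].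
Qed.

Lemma closureQ_normE : normal_closure G Q = <<class_support Q 'N_G(E)>>.
Proof.
congr <<_>>; apply/eqP; rewrite eqEsubset !class_supportEr; apply/andP; split.
  apply/bigcupsP=> g Gg.
  have /mulsgP[a b /setIP[_ nQa] Nb ->] : g \in 'N_G(Q) * 'N_G(E) by rewrite mul_normQE.
  by rewrite conjsgM (normP nQa); apply: (bigcup_sup b Nb).
by apply/bigcupsP=> g /setIP[Gg _]; apply: (bigcup_sup g Gg).
Qed.

Section Normalised.

Hypothesis nQP : pres q G \subset 'N(Q).

(** If [y] does not normalise [Q] then [M] is not normal in [T = <M, y>]; it is
    not maximal either, as otherwise [T] would be generated by [O^q(T)] and a
    Sylow subgroup of [M], which both normalise [Q]. So [M] permutes with [<[y]>], and intersecting
    [M * <[y]>] with the [q]-group [<Q, y>] yields [Q * <[y]>]. *)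
Lemma permQ y : y \in G -> q.-elt y -> commute (Q : {set gT}) <[y]>.
Proof.
move=> Gy qy; have [nQy | not_nQy] := boolP (y \in 'N(Q)).
  by apply/esym/normC; rewrite cycle_subG.
have nEy : y \in 'N(E) by case: (pelt_normQE q_pr qy Gy) => //; rewrite (negPf not_nQy).
pose T := (M <*> <[y]>)%G; have sMT : M \subset T := joing_subl _ _.
have sTG : T \subset G by rewrite join_subG sMG cycle_subG.
have Ty : y \in T by rewrite (subsetP (joing_subr _ _)) ?cycle_id.
have modMT := modularS sMT sTG modM.
have nnMT : ~~ (M <| T).
  apply: contra not_nQy => /normal_norm nMT; apply: (subsetP _ y Ty).
  exact: char_norm_trans (pcore_char q M) nMT.
have nsET : E <| T.
  rewrite /normal (subset_trans sEM) //= join_subG cycle_subG nEy andbT.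
  exact: normal_norm (pcore_normal _ _).
have [sPM | maxM] := modular_cycle_dichotomy modMT q_pr qy (erefl _); last first.
  (* M contains a Sylow q-subgroup of T, so that T is generated by elements of N(Q). *)
  have [pr1 pr2 lt _] := modular_maximal_struct modMT maxM nnMT.
  case/negP: not_nQy; have [S sylS] := Sylow_exists q M.
  have eqs : #|M : gcore M T| = q.
    have : q.-nat #|M : gcore M T|.
      apply: (@pnat_dvd _ #|M : E|).
        by apply: indexgS; rewrite gcore_max ?normal_norm.
      have /and3P[_ _] : q^'.-Hall(M) E := nilpotent_pcore_Hall q^' nilM.
      by rewrite pnatNK.
    by move/pnatP=> /(_ (prime_gt0 pr2) _ pr2 (dvdnn _)); rewrite inE => /eqP.
  have sylST : q.-Sylow(T) S.
    rewrite pHallE (subset_trans (pHall_sub sylS)) //= (card_Hall sylS).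
    rewrite -(Lagrange sMT) partnM ?cardG_gt0 ?indexg_gt0 //.
    rewrite (@part_p'nat _ #|T : M|) ?muln1 // p'natE // dvdn_prime2 //.
    by rewrite ltn_eqF // -eqs.
  apply: (subsetP _ y Ty); rewrite -(pres_pgroup sylST) mul_subG //.
    exact: subset_trans (presS q sTG) nQP.
  exact: subset_trans (pHall_sub sylS) (normal_norm (pcore_normal _ _)).
have defT := modular_pres_permute modMT qy (erefl _) sPM.
have [P sylP sQP] := Sylow_superset sQG qQ.
have sWP := normalised_closure_pgroup nQP sylP sQP.
pose W := <<class_support Q G>>%G.
have qW : q.-group W := pgroupS sWP (pHall_pgroup sylP).
pose U := (Q <*> <[y]>)%G.
have qU : q.-group U.
  have nWy : <[y]> \subset 'N(W).
    by rewrite cycle_subG (subsetP (normal_norm (normal_closure_normal sQG))).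
  apply: (@pgroupS _ q (W <*> <[y]>)); last first.
    by rewrite /= norm_joinEr // pgroupM qW.
  by rewrite genS ?setSU ?sub_normal_closure.
have sUT : U \subset T by rewrite join_subG (subset_trans sQM) ?joing_subr.
have sUMQ : U :&: M \subset Q.
  apply/subsetP=> x /setIP[Ux Mx].
  by rewrite (mem_normal_Hall (nilpotent_pcore_Hall q nilM)) ?pcore_normal ?(mem_p_elt qU).
suff defU : Q * <[y]> = U.
  by apply/comm_group_setP; rewrite defU groupP.
apply/eqP; rewrite eqEsubset mul_subG ?joing_subl ?joing_subr //=.
rewrite -{1}(setIidPr sUT) -defT setIC -group_modr ?joing_subr //.
by rewrite mulSg.
Qed.

Lemma coreFree_normalised : cyclic_factors G 1 (normal_closure G Q).
Proof. exact: normalised_cyclic_factors q_pr qQ sQG nQP coreQ1 permQ. Qed.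

End Normalised.

Section NonNormalised.

Hypothesis not_nQP : ~~ (pres q G \subset 'N(Q)).

Let N := 'N_G(E)%G.
Let sNG : N \subset G := subsetIl G _.
Let nsEM : E <| M := pcore_normal q^' M.
Let sMN : M \subset N. Proof. by rewrite subsetI sMG normal_norm. Qed.
Let nsEN : E <| N. Proof. by rewrite /normal subsetIr andbT (subset_trans sEM). Qed.
Let modMN : modular_subgroup (N / E) (M / E) :=
  modular_quotient nsEN (modularS sMN sNG modM).

Lemma quotientM_pgroup : q.-group (M / E).
Proof. by rewrite -mulM quotientMidr quotient_pgroup. Qed.

(** The [q]-core of the preimage of the core is normalised by ['N_G(E)], so it is
    contained in all conjugates of [Q], because [G = 'N_G(Q) 'N_G(E)]. *)
Lemma quotientM_core : gcore (M / E) (N / E) = 1.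
Proof.
have [C defC sEC nsCN] := inv_quotientN nsEN (gcore_normal (quotientS E sMN)).
have nEC := subset_trans (normal_sub nsCN) (normal_norm nsEN).
have sCM : C \subset M.
  by rewrite -(quotientSGK nEC sEM) -defC gcore_sub.
have nsQCN : 'O_q(C) <| N := char_normal_trans (pcore_char q C) nsCN.
have sQC : 'O_q(C) \subset Q.
  apply: pcore_max; first exact: pcore_pgroup.
  by apply: normalS nsQCN => //; apply: subset_trans (pcore_sub q C) sCM.
have QC1 : 'O_q(C) = 1.
  apply/trivgP; rewrite -coreQ1; apply/bigcapsP=> g Gg.
  have /mulsgP[a b /setIP[_ nQa] Nb ->] : g \in 'N_G(Q) * 'N_G(E) by rewrite mul_normQE.
  by rewrite conjsgM (normP nQa) /= -(normsP (normal_norm nsQCN) b Nb) conjSg.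
have /dprodP[_ mulC _ _] := nilpotent_pcoreC q (nilpotentS sCM nilM).
rewrite QC1 mul1g in mulC; rewrite defC quotientS1 // -mulC.
apply: pcore_max; first exact: pcore_pgroup.
exact: char_normal_trans (pcore_char _ _) (normalS sCM sMN nsCN).
Qed.

Lemma quotientM_bad : exists B : {group coset_of E}, bad (N / E) (M / E) B.
Proof.
have [x [p [Gx not_nQx p_pr neqpq px]]] := p'elt_notin not_nQP.
have nEx : x \in 'N(E) by case: (pelt_normQE p_pr px Gx) => //; rewrite (negPf not_nQx).
exists ((M / E) <*> <[coset E x]>)%G.
have Nx : x \in N by rewrite inE Gx.
have Nxb : coset E x \in N / E by rewrite mem_quotient.
have pxb : p.-elt (coset E x) := morph_p_elt (coset_morphism E) nEx px.
have not_nxb : coset E x \notin 'N(M / E).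
  apply: contra not_nQx => nMx; have nMx' : x \in 'N(M).
    rewrite -(quotientGK nsEM); apply: (subsetP (morphpre_norm _ _)).
    by rewrite mem_morphpre.
  by rewrite -!sub1set in nMx' *; apply: char_norm_trans (pcore_char q M) nMx'.
have [//|[eqpq]] := bad_cycle modMN quotientM_pgroup p_pr pxb Nxb not_nxb.
by rewrite eqpq eqxx in neqpq.
Qed.

Let W := <<class_support Q G>>%G.
Let nsWG : W <| G := normal_closure_normal sQG.
Let sQW : Q \subset W := sub_normal_closure G Q.

Lemma closureQ_centE : W \subset 'C(E).
Proof.
rewrite /= -/(normal_closure G Q) closureQ_normE gen_subG class_supportEr.
apply/bigcupsP=> b /setIP[_ nEb]; rewrite sub_conjg -centJ.
by rewrite (normP (groupVr nEb)) centsC.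
Qed.

Let sWN : W \subset N.
Proof. by rewrite subsetI (normal_sub nsWG) cents_norm ?closureQ_centE. Qed.

Let nEW : W \subset 'N(E) := subset_trans sWN (subsetIr _ _).

Lemma quotientM_prime : #|M / E| = q.
Proof.
by have [B badB] := quotientM_bad; apply: card_bad badB quotientM_core; rewrite ?quotientM_pgroup.
Qed.

Lemma quotientQ_closure : W / E \subset normal_closure (N / E) (M / E).
Proof.
have sMbN : M / E \subset N / E := quotientS E sMN.
have [Z defZ sEZ nsZN] := inv_quotientN nsEN (normal_closure_normal sMbN).
rewrite /normal_closure -[<<_>>]/(gval <<_>>%G) defZ quotientS //=.
rewrite -/(normal_closure G Q) closureQ_normE; apply: normal_closure_sub => //.
rewrite -(quotientSGK (subset_trans sQW nEW) sEZ) -defZ.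
exact: subset_trans (quotientS _ sQM) (sub_normal_closure _ _).
Qed.

(** [Pb] is the subgroup given by [bad_structure] for [M / E] in [N / E], [Z] is
    its preimage in [N], and [P] is the trace of [Z] on the normal closure [W] of
    [Q]. All the subgroups of [P] turn out to be normal in [G]. *)
Section Structure.

Variable Pb : {group coset_of E}.
Hypothesis q'Pb : q^'.-group Pb.
Hypothesis nsPb : forall X : {group coset_of E}, X \subset Pb -> X <| N / E.
Hypothesis cPb : 'C_Pb(M / E) = 1.
Hypothesis closPb : normal_closure (N / E) (M / E) \subset Pb * (M / E).

Let defMb : M / E = Q / E.
Proof. by rewrite -mulM quotientMidr. Qed.

(** The centre of [W] centralises [Q], so its image lies in [M / E] and it is
    contained in [M]; being normal in [G], it is trivial. But [W] centralises
    [E]. *)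
Lemma closureQ_TI : W :&: E = 1.
Proof.
have sZM : 'Z(W) \subset M.
  have nEZ : 'Z(W) \subset 'N(E) := subset_trans (center_sub W) nEW.
  rewrite -(quotientSGK nEZ sEM); apply/subsetP=> _ /morphimP[z nEz Zz ->].
  have [Wz cWz] := setIP Zz; have Wzb : coset E z \in W / E by rewrite mem_quotient.
  have /mulsgP[u m Pu Mm def_z] := subsetP closPb _ (subsetP quotientQ_closure _ Wzb).
  suff u1 : u = 1 by rewrite /= def_z u1 mul1g.
  apply/set1gP; rewrite -cPb inE Pu -(mulgK m u) -def_z groupM //.
    rewrite defMb; apply: (subsetP (quotient_cents E (_ : 'Z(W) \subset _))).
      by rewrite centsC (subset_trans sQW) // centsC subsetIr.
    by rewrite mem_quotient.
  rewrite groupV; apply: (subsetP _ _ Mm); rewrite -abelianE cyclic_abelian //.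
  by rewrite prime_cyclic // quotientM_prime.
have Z1 : 'Z(W) = 1.
  apply/trivgP; rewrite -core1 gcore_max //.
  exact: normal_norm (char_normal_trans (center_char W) nsWG).
apply/trivgP; rewrite -Z1 subsetI subsetIl /=.
by rewrite (subset_trans (subsetIr W E)) // centsC closureQ_centE.
Qed.

Variable Z : {group gT}.
Hypotheses (nsZN : Z <| N) (sEZ : E \subset Z) (defZ : Pb = (Z / E)%G).

Let P := (W :&: Z)%G.
Let sPW : P \subset W := subsetIl W Z.

Lemma quotient_restr (X : {group gT}) : X \subset W -> X \isog X / E.
Proof.
move=> sXW; apply: quotient_isog; first exact: subset_trans sXW nEW.
by apply/trivgP; rewrite -closureQ_TI subsetI subsetIl andbT (subset_trans (subsetIr _ _)).
Qed.

Let sPE : P / E \subset Pb.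
Proof. by rewrite defZ quotientS ?subsetIr. Qed.

Let q'P : q^'.-group P.
Proof. by rewrite (isog_pgroup _ (quotient_restr sPW)) (pgroupS sPE). Qed.

Let tiPQ : P :&: Q = 1.
Proof. by rewrite setIC coprime_TIg // (pnat_coprime qQ). Qed.

Lemma closureQ_mul : P * Q = W.
Proof.
apply/eqP; rewrite eqEsubset mul_subG //; apply/subsetP=> w Ww.
have nEw := subsetP nEW w Ww.
have Wwb : coset E w \in W / E by rewrite mem_quotient.
have /mulsgP[u m Pu] := subsetP closPb _ (subsetP quotientQ_closure _ Wwb).
rewrite defMb => /morphimP[a nEa Qa ->] def_w.
apply/mulsgP; exists (w * a^-1) a; rewrite ?mulgKV //.
have Wa := subsetP sQW a Qa.
rewrite inE groupM ?groupV //=.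
have nZ : w * a^-1 \in 'N(E) by rewrite groupM ?groupV.
rewrite -sub1set -(quotientSGK _ sEZ) ?sub1set // quotient_set1 // sub1set.
have -> : coset E (w * a^-1) = u.
  by rewrite morphM ?groupV // morphV //= def_w mulgK.
by move: Pu; rewrite defZ.
Qed.

Let nsPW : P <| W.
Proof. by rewrite /normal sPW normsI ?normG // (subset_trans sWN) ?normal_norm. Qed.

Let nsPG : P <| G.
Proof.
have hallP : q^'.-Hall(W) P.
  rewrite /pHall sPW q'P pnatNK -card_quotient ?normal_norm //.
  by rewrite -{1}closureQ_mul quotientMidl [_.-nat _]quotient_pgroup.
by rewrite -(normal_Hall_pcore hallP nsPW) (char_normal_trans (pcore_char _ _)).
Qed.

Lemma closureP_normE (X : {group gT}) : X \subset P -> X <| N.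
Proof.
move=> sXP; have sXW := subset_trans sXP sPW; have nEX := subset_trans sXW nEW.
have [Y defY sEY nsYN] := inv_quotientN nsEN (nsPb (subset_trans (quotientS E sXP) sPE)).
have sXY : X \subset Y by rewrite -(quotientSGK nEX sEY) -defY.
have nEY := subset_trans (normal_sub nsYN) (normal_norm nsEN).
have sYEX : Y \subset E * X by rewrite -quotientSK // -defY.
have -> : X = (Y :&: W)%G.
  apply/val_inj/eqP; rewrite eqEsubset subsetI sXY sXW /=.
  apply: subset_trans (setSI _ sYEX) _.
  by rewrite setIC -group_modr //= closureQ_TI mul1g.
rewrite /normal subIset ?(normal_sub nsYN) //=.
rewrite normsI ?normal_norm //; exact: normalS nsWG.
Qed.

Lemma closureP_normQ w : w \in P -> w \in 'N(Q) -> w = 1.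
Proof.
move=> Pw nQw; have nPQ : Q \subset 'N(P) := subset_trans sQW (normal_norm nsPW).
have cQw : <[w]> \subset 'C(Q).
  apply/commG1P/trivgP; rewrite -tiPQ subsetI commg_subr cycle_subG nQw andbT.
  have sPQP : [~: P, Q] \subset P by rewrite commg_subl.
  by apply: subset_trans sPQP; rewrite commSg // cycle_subG.
have nEw : w \in 'N(E) by apply: (subsetP nEW); apply: (subsetP sPW).
apply/set1gP; rewrite -closureQ_TI inE (subsetP sPW) //=.
apply: coset_idr => //; apply/set1gP; rewrite -cPb inE (subsetP sPE) ?mem_quotient //.
rewrite defMb; apply: (subsetP (quotient_cents E cQw)).
by rewrite mem_quotient ?cycle_id.
Qed.

(** Let [y] be an element of prime power order outside ['N(E)], and [w] in [P].
    Then [w] normalises [E], so [y] and [y ^ w] are both outside ['N(E)] and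
    normalise [Q]. So [[~ y, w]] is an element of [P] that normalises [Q],
    whence it is trivial: [y] centralises [P]. *)
Lemma closureP_normal (X : {group gT}) : X \subset P -> X <| G.
Proof.
move=> sXP; rewrite /normal (subset_trans sXP) ?(normal_sub nsPG) //=.
apply: pelt_gen_sub => y p p_pr py Gy /=.
have [nEy | not_nEy] := boolP (y \in 'N(E)).
  by apply: (subsetP (normal_norm (closureP_normE sXP))); rewrite inE Gy.
suff : y \in 'C(P) by apply: subsetP; rewrite cents_norm ?centS.
apply/centP=> w Pw; apply/commgP/eqP; apply: closureP_normQ.
  rewrite commgEr groupM // memJ_norm ?groupV //.
  exact: (subsetP (normal_norm nsPG)).
have normQ z : z \in 'N(E) -> y ^ z \in G -> y ^ z \in 'N(Q).
  move=> nEz Gyz; have pyz : p.-elt (y ^ z) by rewrite /p_elt orderJ.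
  case: (pelt_normQE p_pr pyz Gyz) => //.
  by rewrite groupJr // (negPf not_nEy).
rewrite commgEl groupM ?groupV //.
  by rewrite -[y]conjg1 normQ ?group1 ?conjg1.
apply: normQ; first by apply: (subsetP nEW); apply: (subsetP sPW).
by rewrite groupJ // (subsetP (normal_sub nsPG)).
Qed.

Lemma structure_cyclic_factors : cyclic_factors G 1 W.
Proof.
apply: (cyclic_factors_trans nsPG (sub1G _) sPW).
  exact: cyclic_factors_normal closureP_normal.
apply: cyclic_factors_quotient_cyclic => //.
rewrite -{1}closureQ_mul quotientMidl quotient_cyclic //.
have cycQb : cyclic (Q / E) by rewrite -defMb prime_cyclic // quotientM_prime.
by rewrite (isog_cyclic (quotient_restr sQW)).
Qed.

End Structure.

Lemma coreFree_nonnormalised : cyclic_factors G 1 (normal_closure G Q).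
Proof.
have [B badB] := quotientM_bad.
have [Pb [q'Pb sPbN nsPb cPb closPb]] :=
  bad_structure modMN q_pr quotientM_pgroup badB quotientM_core.
have [Z defZ sEZ nsZN] := inv_quotientN nsEN (nsPb Pb (subxx _)).
exact: (structure_cyclic_factors q'Pb nsPb cPb closPb nsZN sEZ (val_inj defZ)).
Qed.

End NonNormalised.

Lemma coreFree_pcore_factors : cyclic_factors G 1 (normal_closure G 'O_q(M)).
Proof.
have [nQP | not_nQP] := boolP (pres q G \subset 'N(Q)).
  exact: coreFree_normalised.
exact: coreFree_nonnormalised.
Qed.

End CoreFree.

(** * Modular subgroups and their intersections *)

Theorem modular_coreFree_factors (gT : finGroupType) (G M : {group gT}) :
    modular_subgroup G M -> gcore M G = 1 ->
  exists Z : {group gT}, [/\ Z <| G, M \subset Z & cyclic_factors G 1 Z].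
Proof.
move=> modM core1; have sMG : M \subset G by case: modM.
have nilM := modular_corefree_nilpotent modM core1.
have [Z [nsZG sQZ cycZ]] : exists Z : {group gT}, [/\ Z <| G,
    forall q : nat, q \in primes #|M| -> 'O_q(M) \subset Z & cyclic_factors G 1 Z].
  have: all prime (primes #|M|) by apply/allP=> q; rewrite mem_primes => /andP[].
  elim: (primes _) => [_ | q s IHs /= /andP[q_pr /IHs[Z [nsZG sQZ cycZ]]]].
    exists 1%G; split=> //; first exact: normal1.
    by apply: cyclic_factors_normal => X /trivGP->; apply: normal1.
  have sQG : 'O_q(M) \subset G := subset_trans (pcore_sub q M) sMG.
  have nsWG : <<class_support 'O_q(M) G>>%G <| G := normal_closure_normal sQG.
  exists (<<class_support 'O_q(M) G>> <*> Z)%G; split; first exact: normalY.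
    move=> r; rewrite inE => /predU1P[-> | /sQZ sQ].
      exact: subset_trans (sub_normal_closure G [group of 'O_q(M)]) (joing_subl _ _).
    exact: subset_trans sQ (joing_subr _ _).
  apply: cyclic_factors_joing => //.
  exact: coreFree_pcore_factors.
exists Z; split=> //; apply: pelt_gen_sub => x p p_pr px Mx.
have Qx : x \in 'O_p(M).
  by rewrite (mem_normal_Hall (nilpotent_pcore_Hall p nilM)) ?pcore_normal.
have [-> | ntx] := eqVneq x 1; first exact: group1.
apply: (subsetP (sQZ p _)) => //; rewrite mem_primes p_pr cardG_gt0 /=.
have ntX : <[x]> != 1 by rewrite cycle_eq1.
have [_ dvp _] := pgroup_pdiv px ntX.
by apply: dvdn_trans dvp (order_dvdG Mx).
Qed.

(** The chief factors of [G] between the core and the normal closure of a single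
    modular subgroup are cyclic. *)
Theorem modular_factors (gT : finGroupType) (G M : {group gT}) :
  modular_subgroup G M -> cyclic_factors G (gcore M G) (normal_closure G M).
Proof.
move=> modM; have sMG : M \subset G by case: modM.
have nsDG : gcore M G <| G := gcore_normal sMG.
have modMD := modular_quotient nsDG modM.
have coreMD : gcore (M / gcore M G) (G / gcore M G) = 1 := gcore_quotient1 sMG.
have [Zb [nsZb sMZb cycZb]] := modular_coreFree_factors modMD coreMD.
have [Z defZ sDZ nsZG] := inv_quotientN nsDG nsZb.
have sMZ : M \subset Z.
  rewrite -(quotientSGK (subset_trans sMG (normal_norm nsDG)) sDZ) -defZ.
  exact: sMZb.
have cycZ : cyclic_factors G (gcore M G) Z.
  by apply: cyclic_factors_lift => //; rewrite -defZ.
move=> K H chHK sDK sHM; apply: cycZ chHK sDK _.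
exact: subset_trans sHM (normal_closure_sub nsZG sMZ).
Qed.

Theorem corollary1p2 (gT : finGroupType) (G A B : {group gT})
    (modA : modular_subgroup G A) (modB : modular_subgroup G B)
    (K H : {group gT})
    (chiefHK : chief_factor G K H)
    (coreK : gcore (A :&: B) G \subset K)
    (Hclosure : H \subset normal_closure G (A :&: B)) :
  cyclic (H / K).
Proof.
have [sAG sBG] : A \subset G /\ B \subset G by case: modA; case: modB.
have sHA : H \subset normal_closure G A.
  by apply: subset_trans Hclosure _; rewrite genS ?imset2S ?subsetIl.
have sHB : H \subset normal_closure G B.
  by apply: subset_trans Hclosure _; rewrite genS ?imset2S ?subsetIr.
have nsA := gcore_normal sAG; have nsB := gcore_normal sBG.
have sIK : gcore A G :&: gcore B G \subset K.
  apply: subset_trans coreK; rewrite gcore_max ?setISS ?gcore_sub //.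
  by rewrite normsI ?gcore_norm.
have factors (M K' H' : {group gT}) :
    modular_subgroup G M -> M \subset G -> chief_factor G K' H' ->
    H' :&: gcore M G \subset K' -> H' \subset normal_closure G M -> cyclic (H' / K').
  move=> modM sMG ch sI sH.
  apply: cyclic_factors_avoided (gcore_normal sMG) (modular_factors modM) ch sI _.
  rewrite join_subG sH.
  exact: subset_trans (gcore_sub M G) (sub_normal_closure G M).
(* Either A_G avoids H / K, or H / K may be replaced by a chief factor below
   A_G, which B_G avoids. *)
have [sHK | not_sHK] := boolP (H :&: gcore A G \subset K).
  exact: factors modA sAG chiefHK sHK sHA.
have [chHA iso] := chief_covered nsA chiefHK not_sHK.
rewrite (isog_cyclic iso); apply: (factors B) chHA _ _ => //=.
  rewrite subsetI; apply/andP; split; last by rewrite setIAC subsetIr.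
  by apply: subset_trans sIK; rewrite setSI ?subsetIr.
exact: subset_trans (subsetIl _ _) sHB.
Qed.
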